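(* Let $\mathcal{X}$ be a real Banach space with $\dim(\mathcal{X})\ge 3$. If $\mathcal{T}_2(1,1,\mathcal{X})=\sqrt{2}$, then $\mathcal{X}$ is a Hilbert space (that is, its norm is induced by an inner product).
   Context: For a real Banach space $\mathcal{X}$ with unit sphere $S_{\mathcal{X}}$ and $\kappa,\tau>0$, $$\mathcal{T}_2(\kappa,\tau,\mathcal{X})=\sup_{x_1,x_2\in S_{\mathcal{X}}}\big(\|\kappa x_1+\tau x_2\|\,\|\tau x_1-\kappa x_2\|\big)^{1/2}.$$ *)

(* Defs.v *)
From HB Require Import structures.
From mathcomp Require Import all_boot all_order all_algebra.
From mathcomp Require Import sesquilinear.
From mathcomp Require Import all_classical all_reals all_analysis.

Set Implicit Arguments.
Unset Strict Implicit.
Unset Printing Implicit Defensive.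

Import Order.TTheory GRing.Theory Num.Theory.
Import numFieldNormedType.Exports.

Local Open Scope classical_set_scope.
Local Open Scope ring_scope.

Definition unit_sphere {R : realType} (X : normedModType R) : set X :=
  [set x | `|x| = 1].
Arguments unit_sphere {R} X _.

(* For kappa, tau > 0 the values are bounded by kappa + tau, and the unit
   sphere is nonempty as soon as X <> 0, so the real-valued [sup] is the genuine
   least upper bound. *)
Definition T2 {R : realType} (kappa tau : R) (X : normedModType R) : R :=
  sup [set Num.sqrt (`|kappa *: x1 + tau *: x2| * `|tau *: x1 - kappa *: x2|)
      | x1 in unit_sphere X & x2 in unit_sphere X].

Definition lin_indep {R : realType} (X : lmodType R) (n : nat)
    (v : 'I_n -> X) : Prop :=
  forall c : 'I_n -> R, \sum_i c i *: v i = 0 -> forall i, c i = 0.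

(* X may be infinite-dimensional, so the library's dimension of a vectType does
   not apply. *)
Definition dim_ge {R : realType} (n : nat) (X : lmodType R) : Prop :=
  exists v : 'I_n -> X, lin_indep v.

(* [{dot X for idfun}]: symmetric, positive definite bilinear forms on X. *)
Definition norm_from_inner_product {R : realType} (X : normedModType R) : Prop :=
  exists form : {dot X for idfun}, forall x : X, `|x| = Num.sqrt (form x x).

(* Main.v *)
Require Import Defs.
From HB Require Import structures.
From mathcomp Require Import all_boot all_order all_algebra.
From mathcomp Require Import all_classical all_reals all_analysis.
From mathcomp Require Import ring lra.
From mathcomp Require sesquilinear.
Set Implicit Arguments.
Unset Strict Implicit.
Unset Printing Implicit Defensive.
Import Order.TTheory GRing.Theory Num.Theory.
Import numFieldNormedType.Exports.
Local Open Scope classical_set_scope.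
Local Open Scope ring_scope.

(** Write N for the norm.  The hypothesis says N (x + y) * N (x - y) <= 2 for
unit x, y.  If moreover N (x + y) = N (x - y), the pair obtained by adding and
subtracting is again of this kind up to scaling, and this forces the common
value to be the square root of 2 (isosceles_quarter_turn).  Such pairs, called
quarter turns here, therefore maximise the product, and this first-order
condition links the differentials of N: the supporting functionals at x + y
and x - y add up to a multiple of a supporting functional at x
(support_sum_maximal).  Where N is differentiable the differential commutes
with the eighth turn x |-> (x + y) / sqrt 2 (support_rot).

In dimension two this is compatible with non-Euclidean norms, for instance with
small smooth perturbations of the Euclidean norm invariant under a rotation by
an eighth of a turn.  With a third dimension the unit vectors y forming a
quarter turn with a fixed smooth unit vector x are the points of a closed curve.
Along it the linear functional supporting N at x is stationary, by the
first-order condition, so it is constant; as the curve contains -y together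
with y, the constant is 0 (quarter_turn_orthogonal).  Thus forming a quarter turn is the same as lying
in the kernel of the supporting functional, and this relation is symmetric.
One smooth point exists, smoothness propagates along quarter turns, and three
of them reach every point (smooth_everywhere).

Let p, q be unit vectors forming a quarter turn, f and g their supporting
functionals.  On the plane of p and q the quadratic form f^2 + g^2 does not
change when the frame (p, q) is moved, because its variation is of second order
in the displacement (frame_change).  Its value at p is 1, so it is N^2 at every
vector of the plane (plane_euclidean).  Hence the parallelogram law holds in X,
and the theorem of Jordan and von Neumann gives the inner product.

Both rigidity steps (the constant functional on a curve, the constant quadratic
form on a family of frames) rest on constant_of_monotone_increments, which
plays the part of differentiating along a curve that is only known to be
convex. *)

(** * One-variable rigidity and sublinear functionals *)

(** Over a subdivision of [0, 1] into n equal parts the increments of psi add up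
to at most (m 1 - m 0) / n.  In the applications m is, up to a factor and a
linear term, a subgradient of a convex function, chosen point by point. *)
Lemma constant_of_monotone_increments (R : realType) (psi m : R -> R) :
  (forall t u, 0 <= t -> t <= u -> u <= 1 ->
    `|psi u - psi t| <= (m u - m t) * (u - t)) ->
  psi 1 = psi 0.
Proof.
move=> H.
have step (n i : nat) : (i <= n.+1)%N ->
    `|psi (i%:R / n.+1%:R) - psi 0| <= (m (i%:R / n.+1%:R) - m 0) / n.+1%:R.
  elim: i => [|i IH] lein; first by rewrite !mul0r !subrr normr0 mul0r.
  have n0 : (0 : R) < n.+1%:R by rewrite ltr0n.
  have := IH (ltnW lein).
  have : `|psi (i.+1%:R / n.+1%:R) - psi (i%:R / n.+1%:R)| <=
     (m (i.+1%:R / n.+1%:R) - m (i%:R / n.+1%:R)) / n.+1%:R.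
    have e : i.+1%:R / n.+1%:R - i%:R / n.+1%:R = n.+1%:R^-1 :> R.
      by rewrite -mulrBl -natrB // subSnn mul1r.
    have := H (i%:R / n.+1%:R) (i.+1%:R / n.+1%:R); rewrite e; apply.
    - by rewrite divr_ge0.
    - by rewrite ler_pM2r ?invr_gt0 // ler_nat.
    - by rewrite ler_pdivrMr // mul1r ler_nat.
  set a := psi _; set b := psi _; set c := psi 0 => h1 h2.
  rewrite (_ : a - c = (a - b) + (b - c)); last by ring.
  apply: (le_trans (ler_normD _ _)); apply: (le_trans (lerD h1 h2)).
  by rewrite -mulrDl addrA subrK.
apply/eqP; rewrite -subr_eq0 -normr_le0 leNgt; apply/negP => d0.
have [n hn] : exists n : nat, (m 1 - m 0) / `|psi 1 - psi 0| < n.+1%:R.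
  by exists (Num.trunc ((m 1 - m 0) / `|psi 1 - psi 0|)); rewrite truncnS_gt.
have n0 : (0 : R) < n.+1%:R by rewrite ltr0n.
have := step n n.+1 (leqnn _); rewrite divff ?lt0r_neq0 // leNgt => /negP; apply.
by rewrite ltr_pdivrMr // mulrC -ltr_pdivrMr.
Qed.

Section Sublinear.
Variables (R : realType) (V : lmodType R).

Definition sublinear (p : V -> R) :=
  (forall v w, p (v + w) <= p v + p w) /\
  (forall (a : R) v, 0 <= a -> p (a *: v) = a * p v).

Lemma sublinear0 p : sublinear p -> p 0 = 0.
Proof. by case=> _ h; rewrite -(scale0r 0) h // mul0r. Qed.

(** The step of the Hahn-Banach theorem that linearises p along the line of x:
q v is the infimum of p (v + t x) - t p x over t >= 0. *)
Lemma sublinear_odd_at p (x : V) : sublinear p ->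
  exists q, [/\ sublinear q, forall v, q v <= p v & q (- x) = - p x].
Proof.
move=> sp; have [pD pZ] := sp.
pose E v := [set p (v + t *: x) - t * p x | t in [set t : R | 0 <= t]].
have lbE v : lbound (E v) (- p (- v)).
  move=> _ [t /= t0 <-]; have := pD (v + t *: x) (- v).
  by rewrite addrAC subrr add0r pZ //; lra.
have hE v : has_inf (E v).
  split; last by exists (- p (- v)).
  by exists (p (v + 0 *: x) - 0 * p x); exists 0 => /=.
have infE v t : 0 <= t -> inf (E v) <= p (v + t *: x) - t * p x.
  by move=> t0; apply: ge_inf; [case: (hE v) | exists t].
exists (fun v => inf (E v)); split.
- split.
    move=> v w; rewrite -lerBlDr; apply: lb_le_inf; first by case: (hE v).
    move=> _ [t /= t0 <-]; rewrite lerBlDr -lerBlDl.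
    apply: lb_le_inf; first by case: (hE w).
    move=> _ [u /= u0 <-]; rewrite lerBlDl.
    apply: (le_trans (infE _ _ (addr_ge0 t0 u0))).
    have := pD (v + t *: x) (w + u *: x).
    rewrite addrACA -scalerDl mulrDl; lra.
  have mono a v : 0 < a -> inf (E (a *: v)) <= a * inf (E v).
    move=> a0; rewrite mulrC -ler_pdivrMr //; apply: lb_le_inf; first by case: (hE v).
    move=> _ [t /= t0 <-]; rewrite ler_pdivrMr //.
    apply: (le_trans (infE _ _ (mulr_ge0 (ltW a0) t0))).
    by rewrite -scalerA -scalerDr (pZ _ _ (ltW a0)); lra.
  move=> a v; rewrite le_eqVlt => /orP[/eqP <-|a0].
    rewrite scale0r mul0r; apply/eqP; rewrite eq_le; apply/andP; split.
      by have := infE 0 0 (lexx 0); rewrite scale0r mul0r add0r sublinear0 // subr0.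
    apply: lb_le_inf; first by case: (hE 0).
    move=> _ [t /= t0 <-]; rewrite add0r pZ //; lra.
  apply/eqP; rewrite eq_le mono //=.
  have := mono a^-1 (a *: v); rewrite invr_gt0 scalerA mulVf ?gt_eqF // scale1r => /(_ a0).
  by rewrite -(ler_pM2l a0) mulrA divff ?gt_eqF // mul1r.
- by move=> v; have := infE v 0 (lexx 0); rewrite scale0r mul0r addr0 subr0.
- apply/eqP; rewrite eq_le; apply/andP; split.
    have := infE (- x) 1 ler01; rewrite scale1r mul1r addNr sublinear0 //; lra.
  by apply: lb_le_inf; [case: (hE (- x)) | have := lbE (- x); rewrite opprK].
Qed.

(** Oddness at a point survives the passage to a smaller sublinear functional, so
the step above can be repeated along a list. *)
Lemma sublinear_odd_on (s : seq V) p : sublinear p ->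
  exists q, [/\ sublinear q, forall v, q v <= p v &
    forall x, x \in s -> q (- x) = - q x].
Proof.
elim: s p => [|x s IH] p sp; first by exists p.
have [q [sq qp qx]] := sublinear_odd_at x sp.
have [r [sr rq rs]] := IH _ sq.
exists r; split => // [v|y]; first exact: le_trans (rq v) (qp v).
rewrite inE => /orP[/eqP ->|]; last exact: rs.
have := sr.1 x (- x); rewrite subrr sublinear0 //.
have := rq (- x); have := rq x; have := qp x; lra.
Qed.

End Sublinear.

(** * Norms on a three-dimensional space and their supporting functionals *)

Section Norms.
Variables (R : realType) (V : lmodType R).
Implicit Types (f : V -> R) (N : V -> R).

Definition linear_form f :=
  forall (a : R) u v, f (a *: u + v) = a * f u + f v.

Lemma linear_formE f : linear_form f ->
  [/\ forall u v, f (u + v) = f u + f v, forall a u, f (a *: u) = a * f u,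
      forall u, f (- u) = - f u & f 0 = 0].
Proof.
move=> hf; have f0 : f 0 = 0 by have := hf 1 0 0; rewrite scale1r addr0; lra.
have fZ a u : f (a *: u) = a * f u by have := hf a u 0; rewrite !addr0 f0 addr0.
split=> // [u v|u]; first by have := hf 1 u v; rewrite scale1r mul1r.
by rewrite -scaleN1r fZ mulN1r.
Qed.

Lemma lfE f : linear_form f ->
  (forall u v, f (u + v) = f u + f v) * (forall a u, f (a *: u) = a * f u)
  * (forall u, f (- u) = - f u).
Proof. by case/linear_formE. Qed.

Lemma lf0 f : linear_form f -> f 0 = 0.
Proof. by case/linear_formE. Qed.

Lemma linear_form_comb (a b : R) f g : linear_form f -> linear_form g ->
  linear_form (fun v => a * f v + b * g v).
Proof. by move=> hf hg c u v; rewrite !(lfE hf) !(lfE hg); ring. Qed.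

(** A norm as a bare function: the space of row vectors already carries the
maximum norm, and other norms have to be put on it. *)
Definition vector_norm N :=
  [/\ forall v, N v = 0 -> v = 0, forall (a : R) v, N (a *: v) = `|a| * N v &
    forall u v, N (u + v) <= N u + N v].

Section Theory.
Variables (N : V -> R) (hN : vector_norm N).

Lemma norm0_eq0 v : N v = 0 -> v = 0.
Proof. by case: hN => h _ _; exact: h. Qed.

Lemma norm_scale (a : R) v : N (a *: v) = `|a| * N v.
Proof. by case: hN => _ h _; exact: h. Qed.

Lemma norm_triangle u v : N (u + v) <= N u + N v.
Proof. by case: hN => _ _ h; exact: h. Qed.

Lemma norm_0 : N 0 = 0.
Proof. by rewrite -(scale0r 0) norm_scale normr0 mul0r. Qed.

Lemma norm_opp v : N (- v) = N v.
Proof. by rewrite -scaleN1r norm_scale normrN1 mul1r. Qed.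

Lemma norm_subC u v : N (u - v) = N (v - u).
Proof. by rewrite -norm_opp opprB. Qed.

Lemma norm_ge0 v : 0 <= N v.
Proof. have := norm_triangle v (- v); rewrite subrr norm_opp norm_0; lra. Qed.

Lemma norm_gt0 v : v != 0 -> 0 < N v.
Proof.
by move=> v0; rewrite lt0r norm_ge0 andbT; apply: contra_neq v0; exact: norm0_eq0.
Qed.

Lemma norm_scale_ge0 a v : 0 <= a -> N (a *: v) = a * N v.
Proof. by move=> a0; rewrite norm_scale ger0_norm. Qed.

Lemma norm_normalize v : v != 0 -> N ((N v)^-1 *: v) = 1.
Proof.
move=> v0; have := norm_gt0 v0 => n0.
by rewrite norm_scale_ge0 ?invr_ge0 ?ltW // mulVf ?gt_eqF.
Qed.

Lemma norm_distance u v : `|N u - N v| <= N (u - v).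
Proof.
have := norm_triangle (u - v) v; have := norm_triangle (v - u) u.
rewrite !subrK (norm_subC v u) => h1 h2; rewrite ler_norml; apply/andP; split; lra.
Qed.

Lemma norm1_neq0 x : N x = 1 -> x != 0.
Proof. by move=> x1; apply/eqP => x0; move/eqP: x1; rewrite x0 norm_0 eq_sym oner_eq0. Qed.

Definition supports f x := [/\ linear_form f, f x = N x & forall v, f v <= N v].

(** Uniqueness of the supporting functional, which is Gateaux differentiability
of N at x. *)
Definition smooth x := forall f g, supports f x -> supports g x -> f =1 g.

Lemma supports_abs f x v : supports f x -> `|f v| <= N v.
Proof.
case=> hf _ fN; rewrite ler_norml fN andbT.
by have := fN (- v); rewrite (lfE hf) norm_opp; lra.
Qed.

Lemma supportsZ f x a : 0 < a -> supports f (a *: x) <-> supports f x.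
Proof.
move=> a0; split=> -[hf fx fN]; split=> //.
  move: fx; rewrite (lfE hf) norm_scale_ge0 ?(ltW a0) //.
  by apply: mulfI; rewrite gt_eqF.
by rewrite (lfE hf) norm_scale_ge0 ?(ltW a0) // fx.
Qed.

Lemma smoothZ x a : 0 < a -> smooth (a *: x) <-> smooth x.
Proof.
by move=> a0; split=> sx f g hf hg; apply: sx; apply/(supportsZ _ _ a0).
Qed.

Lemma supportsN f x : supports f x -> supports (fun v => - f v) (- x).
Proof.
case=> hf fx fN; split; first by move=> a u v; rewrite !(lfE hf); ring.
  by rewrite (lfE hf) opprK norm_opp.
by move=> v; rewrite -(lfE hf) (le_trans (fN _)) // norm_opp.
Qed.

Lemma smoothN x : smooth x -> smooth (- x).
Proof.
move=> sx f g /supportsN; rewrite opprK => hf /supportsN; rewrite opprK => hg v.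
by have := sx _ _ hf hg v; lra.
Qed.

Lemma sublinear_norm : sublinear N.
Proof. by split; [exact: (norm_triangle) | exact: norm_scale_ge0]. Qed.

End Theory.
End Norms.

Section ThreeSpace.
Variable R : realType.
Notation V := 'rV[R]_3.
Variables (N : V -> R) (hN : vector_norm N).

Lemma row_sum_delta (v : V) : v = \sum_i v 0 i *: delta_mx 0 i.
Proof. exact: row_sum_delta. Qed.

(** A sublinear functional that is odd on a basis is linear.  Its value at - x is
at most - N x, so it supports N at x. *)
Lemma exists_support (x : V) : exists f, supports N f x.
Proof.
have [p [sp pN px]] := sublinear_odd_at x (sublinear_norm hN).
have [f [sf fp fodd]] := sublinear_odd_on [seq delta_mx 0 i | i : 'I_3] sp.
have fD v w : f (- v) = - f v -> f (- w) = - f w ->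
    f (v + w) = f v + f w /\ f (- (v + w)) = - f (v + w).
  move=> fv fw; have := sf.1 v w; have := sf.1 (- v) (- w).
  have := sf.1 (v + w) (- (v + w)); rewrite subrr sublinear0 //.
  rewrite -opprD fv fw; move: (f (v + w)) (f (- (v + w))) => a b h1 h2 h3.
  by split; lra.
have fZ a v : f (- v) = - f v ->
    f (a *: v) = a * f v /\ f (- (a *: v)) = - f (a *: v).
  move=> fv; have [a0|a0] := leP 0 a.
    by rewrite -scalerN !sf.2 // fv; split=> //; ring.
  have a0' : 0 <= - a by lra.
  rewrite -scaleNr (sf.2 _ _ a0') -[a *: v]opprK -scaleNr -scalerN sf.2 // fv.
  by split; ring.
have odd v : f (- v) = - f v.
  rewrite (row_sum_delta v); elim/big_rec : _ => [|i w _ hw].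
    by rewrite oppr0 sublinear0 // oppr0.
  have h : f (- delta_mx 0 i) = - f (delta_mx 0 i).
    by apply: fodd; apply/mapP; exists i => //; rewrite mem_enum.
  by case: (fD _ _ (fZ (v 0 i) _ h).2 hw).
exists f; split.
- move=> a u v; rewrite (fD _ _ (odd _) (odd _)).1.
  by rewrite (fZ _ _ (odd _)).1.
- apply/eqP; rewrite eq_le (le_trans (fp _) (pN _)) /=.
  by have := odd x; have := fp (- x); rewrite px; lra.
- by move=> v; exact: le_trans (fp _) (pN _).
Qed.

(** The triangle inequality bounds N by a multiple of the maximum norm. *)
Lemma norm_continuous : continuous N.
Proof.
pose K := \sum_i N (delta_mx 0 i : V) + 1.
have K0 : 0 < K.
  by rewrite ltr_pwDr // sumr_ge0 // => i _; exact: norm_ge0.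
have NK v : N v <= K * `|v|.
  have h : N v <= \sum_i `|v 0 i| * N (delta_mx 0 i).
    rewrite {1}(row_sum_delta v); elim/big_rec2 : _ => [|i r w _ hw].
      by rewrite norm_0.
    apply: (le_trans (norm_triangle hN _ _)).
    by rewrite (norm_scale hN) lerD2l.
  apply: (le_trans h); rewrite mulrDl mul1r mulr_suml.
  rewrite -[leLHS]addr0 lerD // ler_sum // => i _.
  rewrite mulrC ler_wpM2l ?norm_ge0 //.
  by rewrite [leRHS]/Num.Def.normr /= mx_normrE (le_bigmax _ (fun ij => `|v ij.1 ij.2|) (0, i)).
move=> v; suff h e : 0 < e -> \forall w \near v, `|N v - N w| <= e.
  exact/(@cvgrPdist_le _ _ _ (nbhs v)).
move=> e0.
have : \forall w \near v, `|v - w| <= e / K.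
  by apply: (@cvgr_dist_le _ _ _ (nbhs v)) => //; rewrite divr_gt0.
apply: filterS => w hw; apply: (le_trans (norm_distance hN _ _)).
by apply: (le_trans (NK _)); rewrite mulrC -ler_pdivlMr.
Qed.

(** The only way in which the third dimension enters the rigidity arguments. *)
Lemma common_kernel (p r : V -> R) : linear_form p -> linear_form r ->
  exists z, [/\ z != 0, p z = 0 & r z = 0].
Proof.
move=> hp hr.
pose A : 'M[R]_(3, 2) :=
  \matrix_(i, j) (if j == 0 then p (delta_mx 0 i) else r (delta_mx 0 i)).
have lfA (f : V -> R) : linear_form f -> forall v : V, f v = \sum_i v 0 i * f (delta_mx 0 i).
  move=> hf v; rewrite {1}(row_sum_delta v).
  elim/big_rec2 : _ => [|i s w _ <-]; first exact: lf0.
  by rewrite !(lfE hf).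
have : kermx A != 0.
  rewrite -mxrank_eq0 mxrank_ker -lt0n subn_gt0.
  exact: leq_ltn_trans (rank_leq_col A) _.
case/rowV0Pn => z /sub_kermxP zA z0.
exists z; split=> //.
  move/matrixP/(_ 0 0): (zA); rewrite !mxE (lfA p) // => e.
  by rewrite -[RHS]e; apply: eq_bigr => i _; rewrite mxE.
move/matrixP/(_ 0 1): (zA); rewrite !mxE (lfA r) // => e.
by rewrite -[RHS]e; apply: eq_bigr => i _; rewrite mxE.
Qed.

(** On the arc from - x to x through d, the difference N (x + y) - N (x - y)
goes from - 2 to 2. *)
Lemma isosceles_in_half_plane (x d : V) : N x = 1 -> (forall a, d != a *: x) ->
  exists l k, let y := l *: d + k *: x in
    [/\ 0 < l, N y = 1 & N (x + y) = N (x - y)].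
Proof.
move=> x1 dx.
(* The arc z runs from - x to x, through d. *)
pose z (t : R) : V := (1 - t * t) *: d + t *: x.
pose G t := N (N (z t) *: x + z t) - N (N (z t) *: x - z t).
have cid : continuous (fun t : R => t) by move=> t; exact: cvg_id.
have cz : continuous z.
  move=> t; apply: cvgD; apply: cvgZr_tmp; last exact: cid.
  by apply: cvgB; [exact: cvg_cst | apply: cvgM; exact: cid].
have cNz : continuous (fun t => N (z t)).
  by move=> t; apply: continuous_comp; [exact: cz | exact: norm_continuous].
have cG : continuous G.
  move=> t; apply: cvgB.
    apply: (@continuous_comp _ _ _ (fun t => N (z t) *: x + z t) N); last first.
      exact: norm_continuous.
    by apply: cvgD; [apply: cvgZr_tmp; exact: cNz | exact: cz].
  apply: (@continuous_comp _ _ _ (fun t => N (z t) *: x - z t) N); last first.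
    exact: norm_continuous.
  by apply: cvgB; [apply: cvgZr_tmp; exact: cNz | exact: cz].
have z1 : z 1 = x by rewrite /z mulr1 subrr scale0r add0r scale1r.
have zN1 : z (-1) = - x by rewrite /z mulrNN mulr1 subrr scale0r add0r scaleN1r.
have G1 : G 1 = 2.
  rewrite /G z1 x1 scale1r subrr norm_0 // subr0 -mulr2n -scaler_nat.
  by rewrite (norm_scale hN) x1 ger0_norm // mulr1.
have GN1 : G (-1) = - 2.
  rewrite /G zN1 (norm_opp hN) x1 scale1r subrr norm_0 // sub0r opprK.
  by rewrite -mulr2n -scaler_nat (norm_scale hN) x1 ger0_norm // mulr1.
have [t tI Gt] : exists2 t, t \in `[(-1 : R), 1]%R & G t = 0.
  apply: IVT; [lra | exact: continuous_subspaceT |].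
  by rewrite G1 GN1 ge_min le_max; apply/andP; split; apply/orP; [left|right]; lra.
move: tI; rewrite in_itv /= => /andP[tN1 t1].
have tN1' : t != -1 by apply/eqP => e; move: Gt; rewrite e GN1; lra.
have t1' : t != 1 by apply/eqP => e; move: Gt; rewrite e G1; lra.
have l0 : 0 < 1 - t * t.
  have : -1 < t by rewrite lt_neqAle eq_sym tN1' tN1.
  have : t < 1 by rewrite lt_neqAle t1' t1.
  by move=> h1 h2; nra.
have z0 : z t != 0.
  apply: contra_neq (dx (- (1 - t * t)^-1 * t)) => zt0.
  have : (1 - t * t)^-1 *: z t = 0 by rewrite zt0 scaler0.
  rewrite /z scalerDr scalerA mulVf ?gt_eqF // scale1r scalerA => /eqP.
  by rewrite addr_eq0 mulNr scaleNr => /eqP.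
have n0 := norm_gt0 hN z0.
exists ((N (z t))^-1 * (1 - t * t)), ((N (z t))^-1 * t) => /=.
rewrite -!scalerA -scalerDr -/(z t); split.
- by rewrite mulr_gt0 ?invr_gt0.
- exact: norm_normalize.
- have nD (w : V) (n : R) : 0 < n -> x + n^-1 *: w = n^-1 *: (n *: x + w).
    by move=> hn; rewrite scalerDr scalerA mulVf ?gt_eqF // scale1r.
  rewrite -scalerN !nD // !(norm_scale hN); congr (_ * _).
  by move/eqP: Gt; rewrite subr_eq0 => /eqP.
Qed.

(** Let c maximise N on the Euclidean unit sphere.  A functional below N is below
N c times the Euclidean norm; if it supports N at c, equality holds at c, which
leaves only N c times the scalar product with c. *)
Lemma exists_smooth_unit : exists x, N x = 1 /\ smooth N x.
Proof.
pose dot (u v : V) := \sum_i u 0 i * v 0 i.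
have dotC u v : dot u v = dot v u by apply: eq_bigr => i _; rewrite mulrC.
have dotDr u v w : dot u (v + w) = dot u v + dot u w.
  by rewrite -big_split; apply: eq_bigr => i _; rewrite mxE mulrDr.
have dotZr a u v : dot u (a *: v) = a * dot u v.
  by rewrite mulr_sumr; apply: eq_bigr => i _; rewrite mxE mulrCA.
have dot_ge0 v : 0 <= dot v v by apply: sumr_ge0 => i _; rewrite -expr2 sqr_ge0.
have dot_gt0 v : v != 0 -> 0 < dot v v.
  move=> v0; rewrite lt_neqAle dot_ge0 andbT eq_sym; apply: contra_neq v0 => d0.
  have h i : v 0 i * v 0 i = 0.
    move/eqP: d0; rewrite psumr_eq0 => [/allP /(_ i (mem_index_enum _)) /eqP //|j _].
    by rewrite -expr2 sqr_ge0.
  by apply/rowP => i; rewrite mxE; apply/eqP; rewrite -sqrf_eq0 expr2 h.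
pose A := [set v : V | dot v v = 1].
have cdot : continuous (fun v : V => dot v v).
  apply: (@continuous_big R _ +%R 0 xpredT (@add_continuous R) _ _ (fun i (v : V) => v 0 i * v 0 i)) => i _.
  by move=> v; apply: cvgM; first exact: nbhs_filter; exact: (@coord_continuous R 1 3 0 i v).
have cA : compact A.
  apply: bounded_closed_compact; last first.
    by apply: (@preimage_closed _ _ (fun v : V => dot v v) [set 1]) => //; exact: closed_eq.
  exists 1; split => // M M1 v /= v1.
  rewrite /Num.Def.normr /= mx_normrE; apply/bigmax_leP; split; first by lra.
  move=> [i j] _ /=; apply: le_trans (ltW M1); rewrite ord1.
  rewrite -(ler_pXn2r (ltn0Sn 1)) ?nnegrE // expr1n real_normK ?num_real //.
  by rewrite -v1 /dot (bigD1 j) //= expr2 lerDl sumr_ge0 // => k _; rewrite -expr2 sqr_ge0.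
have A0 : A !=set0.
  exists (delta_mx 0 0); rewrite /A /= /dot (bigD1 0) //= big1 ?addr0.
    by rewrite !mxE eqxx mulr1.
  by move=> i i0; rewrite !mxE (negPf i0) andbF mulr0.
have [c cA1 cmax] := EVT_max_rV A0 cA (continuous_subspaceT norm_continuous).
have {cA1} c1 : dot c c = 1 by move: cA1; rewrite inE.
set M := N c in cmax.
have c0 : c != 0.
  apply/eqP => e; move: c1; rewrite e /dot big1 => [/eqP|i _]; last by rewrite mxE mul0r.
  by rewrite eq_sym oner_eq0.
have M0 : 0 < M := norm_gt0 hN c0.
have NM v : N v ^+ 2 <= M ^+ 2 * dot v v.
  have [->|v0] := eqVneq v 0.
    by rewrite norm_0 // expr0n mulr_ge0 ?sqr_ge0.
  have D0 := dot_gt0 v v0; pose r := Num.sqrt (dot v v).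
  have r0 : 0 < r by rewrite sqrtr_gt0.
  have rr : r ^+ 2 = dot v v by rewrite sqr_sqrtr ?ltW.
  have : N (r^-1 *: v) <= M.
    apply: cmax; rewrite inE /A /= dotZr dotC dotZr -rr.
    by field; rewrite gt_eqF.
  rewrite norm_scale_ge0 ?invr_ge0 ?(ltW r0) // mulrC ler_pdivrMr // => h.
  rewrite -rr -exprMn; apply: lerXn2r h; first by rewrite nnegrE norm_ge0.
  by rewrite nnegrE mulr_ge0 ?(ltW M0) ?(ltW r0).
have fE f : supports N f c -> f =1 fun w => M * dot c w.
  move=> [hf fc fN] w.
  have [u [cu uE]] : exists u, dot c u = 0 /\ w = u + dot c w *: c.
    exists (w - dot c w *: c).
    by rewrite dotDr -scaleNr dotZr c1 mulr1 subrr scaleNr subrK.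
  suff fu : f u = 0.
    by rewrite {1}uE !(lfE hf) fu fc add0r mulrC.
  apply/eqP/negP => /negP fu0.
  have key t : 0 <= t * f u -> 2 * M * (t * f u) <= M ^+ 2 * (t ^+ 2 * dot u u).
    move=> tf; have := NM (c + t *: u).
    have : f (c + t *: u) <= N (c + t *: u) := fN _.
    rewrite !(lfE hf) fc dotDr dotZr [dot _ c]dotC [dot _ u]dotC !dotDr !dotZr.
    rewrite c1 cu [dot u c]dotC cu -/M => h1 h2; nra.
  pose D := dot u u; have D0 : 0 <= D := dot_ge0 u.
  pose e := (M * D + 1)^-1.
  have MD : 0 < M * D + 1 by rewrite ltr_pwDr // mulr_ge0 // ltW.
  have e0 : 0 < e by rewrite invr_gt0.
  have f2 : 0 < f u ^+ 2 by rewrite exprn_even_gt0.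
  have h : 0 <= e * f u * f u by rewrite -mulrA -expr2 mulr_ge0 // ltW.
  have := key _ h; rewrite exprMn -/D.
  have -> : M ^+ 2 * (e ^+ 2 * f u ^+ 2 * D) = (M * e * f u ^+ 2) * (e * (M * D)) by ring.
  have -> : 2 * M * (e * f u * f u) = (M * e * f u ^+ 2) * 2 by ring.
  rewrite (ler_pM2l (mulr_gt0 (mulr_gt0 M0 e0) f2)).
  have : e * (M * D) < 1 by rewrite mulrC ltr_pdivrMr // mul1r ltrDl.
  lra.
exists (M^-1 *: c); split; first exact: norm_normalize.
have Mi : 0 < M^-1 by rewrite invr_gt0.
apply: (smoothZ hN c Mi).2.
by move=> f g hf hg w; rewrite (fE _ hf) (fE _ hg).
Qed.

End ThreeSpace.

(** * Quarter turns and the first-order condition *)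

Section James.
Variable R : realType.
Notation V := 'rV[R]_3.
Variables (N : V -> R) (hN : vector_norm N).
Hypothesis hJ : forall x y, N x = 1 -> N y = 1 -> N (x + y) * N (x - y) <= 2.

Notation s := (Num.sqrt 2 : R).

Lemma sqrt2_facts : [/\ 1 < s, s < 3 / 2 & s * s = 2].
Proof.
have ss : s * s = 2 by rewrite -expr2 sqr_sqrtr.
have s0 : 0 < s by rewrite sqrtr_gt0.
split=> //; nra.
Qed.

(** The name refers to the Euclidean case; (x + y) / sqrt 2 and (x - y) / sqrt 2
are then at an eighth of a turn from x. *)
Definition quarter_turn x y :=
  [/\ N x = 1, N y = 1, N (x + y) = s & N (x - y) = s].

(** With t = N (x + y), the pair (x + y) / t, (x - y) / t has sum 2 x / t and
difference 2 y / t.  The bound for both pairs gives t^2 <= 2 and 4 / t^2 <= 2. *)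
Lemma isosceles_quarter_turn x y :
  N x = 1 -> N y = 1 -> N (x + y) = N (x - y) -> quarter_turn x y.
Proof.
move=> x1 y1 e; have [s1 s2 ss] := sqrt2_facts.
suff h : N (x + y) = s by split=> //; rewrite -e.
have := hJ x1 y1; rewrite -e; set t := N (x + y) in e *; move=> tt.
have t0 : 0 < t.
  rewrite lt_neqAle (norm_ge0 hN) // andbT; apply/negP => /eqP t0.
  have := norm_triangle hN (x + y) (x - y).
  have -> : x + y + (x - y) = 2 *: x by apply/rowP => i; rewrite !mxE; ring.
  by rewrite (norm_scale_ge0 hN) // x1 -e -/t -t0; lra.
have h0 : 0 <= t^-1 by rewrite invr_ge0 ltW.
have u1 : N (t^-1 *: (x + y)) = 1 by rewrite (norm_scale_ge0 hN) // mulVf ?gt_eqF.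
have v1 : N (t^-1 *: (x - y)) = 1.
  by rewrite (norm_scale_ge0 hN) // -e mulVf ?gt_eqF.
have := hJ u1 v1.
have -> : t^-1 *: (x + y) + t^-1 *: (x - y) = (2 * t^-1) *: x.
  by apply/rowP => i; rewrite !mxE; ring.
have -> : t^-1 *: (x + y) - t^-1 *: (x - y) = (2 * t^-1) *: y.
  by apply/rowP => i; rewrite !mxE; ring.
rewrite !(norm_scale_ge0 hN) ?mulr_ge0 // x1 y1 !mulr1 => h.
have tV : t * t^-1 = 1 by rewrite divff ?gt_eqF.
have : 2 <= t * t.
  have : (t * t) * (2 * t^-1 * (2 * t^-1)) <= (t * t) * 2 by rewrite ler_wpM2l // mulr_ge0 // ltW.
  rewrite (_ : t * t * _ = 4 * (t * t^-1) ^+ 2); last by ring.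
  by rewrite tV; lra.
by move=> h'; nra.
Qed.

Lemma quarter_turn_sym x y : quarter_turn x y -> quarter_turn y x.
Proof. by case=> x1 y1 h1 h2; split=> //; [rewrite addrC | rewrite (norm_subC hN)]. Qed.

Lemma quarter_turnN x y : quarter_turn x y -> quarter_turn x (- y).
Proof. by case=> x1 y1 h1 h2; split; rewrite ?(norm_opp hN) ?opprK. Qed.

Lemma quarter_turn_rot x y : quarter_turn x y ->
  quarter_turn (s^-1 *: (x + y)) (s^-1 *: (x - y)).
Proof.
have [s1 s2 ss] := sqrt2_facts.
have s0 : 0 < s by lra.
have h0 : 0 <= s^-1 by rewrite invr_ge0 ltW.
have sV : 2 * s^-1 = s by rewrite -{1}ss -mulrA divff ?gt_eqF // mulr1.
case=> x1 y1 h1 h2; split.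
- by rewrite (norm_scale_ge0 hN) // h1 mulVf ?gt_eqF.
- by rewrite (norm_scale_ge0 hN) // h2 mulVf ?gt_eqF.
- have -> : s^-1 *: (x + y) + s^-1 *: (x - y) = (2 * s^-1) *: x.
    by apply/rowP => i; rewrite !mxE; ring.
  by rewrite sV (norm_scale_ge0 hN) ?(ltW s0) // x1 mulr1.
- have -> : s^-1 *: (x + y) - s^-1 *: (x - y) = (2 * s^-1) *: y.
    by apply/rowP => i; rewrite !mxE; ring.
  by rewrite sV (norm_scale_ge0 hN) ?(ltW s0) // y1 mulr1.
Qed.

Lemma support_sum_pos x y f g : quarter_turn x y ->
  supports N f (x + y) -> supports N g (x - y) -> 0 < f x /\ 0 < g x.
Proof.
have [s1 s2 ss] := sqrt2_facts.
case=> x1 y1 h1 h2 [hf fxy fN] [hg gxy gN].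
have := fN y; have := gN (- y); rewrite (norm_opp hN) // y1.
move: fxy gxy; rewrite !(lfE hf) !(lfE hg) h1 h2; lra.
Qed.

(** As N (x + y) * N (x - y) is maximal, moving x towards z on the sphere cannot
increase f + g to first order.  Quantitatively, for a displacement of size t,
f and g change by O(t), and their product exceeds 2 by sqrt 2 times the change
of f + g up to O(t^2). *)
Lemma support_sum_maximal x y f g z : quarter_turn x y ->
  supports N f (x + y) -> supports N g (x - y) ->
  f z + g z <= N z * (f x + g x).
Proof.
move=> q sf sg; have [s1 s2 ss] := sqrt2_facts.
have [fx0 gx0] := support_sum_pos q sf sg.
have [x1 y1 h1 h2] := q.
have [hf fxy fN] := sf; have [hg gxy gN] := sg.
rewrite !(lfE hf) h1 in fxy; rewrite !(lfE hg) h2 in gxy.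
have unit_case w : N w = 1 -> f w + g w <= f x + g x.
  move=> w1; rewrite leNgt; apply/negP => hlt.
  pose d := f w + g w - (f x + g x).
  have d0 : 0 < d by rewrite /d; lra.
  have fw := fN w; have gw := gN w; rewrite w1 in fw gw.
  have fx1 := fN x; have gx1 := gN x; rewrite x1 in fx1 gx1.
  have fw' := fN (- w); have gw' := gN (- w).
  rewrite !(lfE hf) (norm_opp hN) // w1 in fw'.
  rewrite !(lfE hg) (norm_opp hN) // w1 in gw'.
  have d2 : d <= 2 by rewrite /d; lra.
  (* f + g gains at least t * d, and the two changes have a product of at
     most 64 * t ^ 2 in absolute value. *)
  pose t := d / 128.
  have t0 : 0 < t by rewrite /t; lra.
  have t1 : t <= 1 / 64 by rewrite /t; lra.
  pose v : V := (1 - t) *: x + t *: w.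
  have n1 : N v <= 1.
    apply: (le_trans (norm_triangle hN _ _)).
    by rewrite !(norm_scale_ge0 hN) // ?x1 ?w1; lra.
  have n2 : 1 - 2 * t <= N v.
    have := norm_triangle hN v (- (t *: w)).
    rewrite /v addrK (norm_opp hN) // !(norm_scale_ge0 hN) //; try lra.
    by rewrite x1 w1; lra.
  have n0 : 0 < N v by lra.
  have fv : f v = (1 - t) * f x + t * f w by rewrite /v !(lfE hf).
  have gv : g v = (1 - t) * g x + t * g w by rewrite /v !(lfE hg).
  move: n1 n2 n0 fv gv; clearbody v.
  set n := N v => n1 n2 n0 fv gv.
  have u1 : N (n^-1 *: v) = 1.
    by rewrite (norm_scale_ge0 hN) ?invr_ge0 ?(ltW n0) // mulVf ?gt_eqF.
  have := hJ u1 y1.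
  have := fN (n^-1 *: v + y); have := gN (n^-1 *: v - y).
  rewrite !(lfE hf) !(lfE hg).
  move: (N (n^-1 *: v + y)) (N (n^-1 *: v - y)) => a b.
  pose P := n^-1 * f v - f x; pose Q := n^-1 * g v - g x.
  have -> : n^-1 * f v + f y = s + P by rewrite /P; lra.
  have -> : n^-1 * g v - g y = s + Q by rewrite /Q; lra.
  have nn : n * n^-1 = 1 by rewrite divff ?gt_eqF.
  have nP : n * P = (1 - n) * f x + t * (f w - f x).
    rewrite /P mulrBr mulrA nn fv; ring.
  have nQ : n * Q = (1 - n) * g x + t * (g w - g x).
    rewrite /Q mulrBr mulrA nn gv; ring.
  have n12 : 1 / 2 <= n by lra.
  have bnd A B : 0 < B -> B <= 1 -> - 1 <= A -> A <= 1 -> forall P0,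
      n * P0 = (1 - n) * B + t * (A - B) -> - (8 * t) <= P0 <= 8 * t.
    move=> B0 B1 A0 A1 P0 e.
    have e1 : - (4 * t) <= n * P0 by rewrite e; nra.
    have e2 : n * P0 <= 4 * t by rewrite e; nra.
    by apply/andP; split; nra.
  have fw1 : -1 <= f w by lra.
  have gw1 : -1 <= g w by lra.
  have /andP[P1 P2] := bnd _ _ fx0 fx1 fw1 fw _ nP.
  have /andP[Q1 Q2] := bnd _ _ gx0 gx1 gw1 gw _ nQ.
  have PQ : t * d <= P + Q.
    have e : n * (P + Q) = (1 - n) * (f x + g x) + t * d.
      by rewrite mulrDr nP nQ /d; ring.
    have e1 : t * d <= n * (P + Q).
      by rewrite e lerDr mulr_ge0 //; lra.
    have td : 0 < t * d by rewrite mulr_gt0.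
    clear - e1 n1 n0 td. nra.
  move=> hb ha hab.
  have sP : 0 < s + P by lra.
  have sQ : 0 < s + Q by lra.
  have AB : (s + P) * (s + Q) <= 2.
    by apply: le_trans hab; rewrite ler_pM // ltW.
  have PQ2 : - (64 * t * t) <= P * Q.
    clear - P1 P2 Q1 Q2 t0. nra.
  have e1 : t * d <= 64 * t * t.
    have : s * (P + Q) + P * Q <= 0.
      have -> : s * (P + Q) + P * Q = (s + P) * (s + Q) - s * s by ring.
      by rewrite ss; lra.
    have : t * d <= s * (P + Q).
      have td : 0 < t * d by rewrite mulr_gt0.
      clear - PQ td s1. nra.
    lra.
  have : t * (d - 64 * t) <= 0 by rewrite mulrBr; lra.
  by rewrite pmulr_rle0 // /t; lra.
have [->|z0] := eqVneq z 0.
  by rewrite (lf0 hf) (lf0 hg) (norm_0 hN) mul0r addr0.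
have := unit_case _ (norm_normalize hN z0).
rewrite !(lfE hf) !(lfE hg) -mulrDr mulrC.
by rewrite ler_pdivrMr ?(norm_gt0 hN) // mulrC.
Qed.
End James.

(** * Smooth points *)

Section Smooth.
Variable R : realType.
Notation V := 'rV[R]_3.
Variables (N : V -> R) (hN : vector_norm N).
Hypothesis hJ : forall x y, N x = 1 -> N y = 1 -> N (x + y) * N (x - y) <= 2.
Notation s := (Num.sqrt 2 : R).

(** By the first-order condition f + g is a multiple of a supporting functional
at x. *)
Lemma support_sum_smooth x y f g p : quarter_turn N x y -> smooth N x ->
  supports N f (x + y) -> supports N g (x - y) -> supports N p x ->
  forall z, f z + g z = (f x + g x) * p z.
Proof.
move=> q sx sf sg sp z; have [fx0 gx0] := support_sum_pos hN q sf sg.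
have a0 : 0 < f x + g x by exact: addr_gt0.
have [x1 _ _ _] := q; have [hf _ _] := sf; have [hg _ _] := sg.
suff sh : supports N (fun v => (f x + g x)^-1 * f v + (f x + g x)^-1 * g v) x.
  by rewrite -(sx _ _ sh sp) -mulrDr mulrA divff ?gt_eqF // mul1r.
split; first exact: linear_form_comb.
  by rewrite -mulrDr mulVf ?gt_eqF.
move=> v; rewrite -mulrDr mulrC ler_pdivrMr //.
exact: (support_sum_maximal hN hJ v q sf sg).
Qed.

Lemma quarter_turn_support_gt x y p : quarter_turn N x y -> supports N p x ->
  - 1 / 2 < p y /\ p y < 1 / 2.
Proof.
have [s1 s2 ss] := sqrt2_facts R; case=> x1 y1 h1 h2 [hp px pN].
have := pN (x + y); have := pN (x - y); rewrite !(lfE hp) px x1 h1 h2.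
by move=> h h'; split; lra.
Qed.

(** Two supporting functionals at x + y differ by a multiple of p, and they agree
at x + y, where p does not vanish. *)
Lemma smooth_sum x y : quarter_turn N x y -> smooth N x -> smooth N (x + y).
Proof.
move=> q sx f1 f2 sf1 sf2 z.
have [g sg] := exists_support hN (x - y); have [p sp] := exists_support hN x.
have h1 := support_sum_smooth q sx sf1 sg sp.
have h2 := support_sum_smooth q sx sf2 sg sp.
have [py _] := quarter_turn_support_gt q sp.
have [x1 _ _ _] := q.
have [_ f1w _] := sf1; have [_ f2w _] := sf2; have [hp px _] := sp.
have := h1 (x + y); have := h2 (x + y); rewrite f1w f2w (lfE hp) px x1 => e2 e1.
have e : f1 x + g x = f2 x + g x.
  by apply: (@mulIf _ (1 + p y)); [rewrite gt_eqF //; lra | rewrite -e1 -e2].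
by have := h1 z; have := h2 z; rewrite e; lra.
Qed.

Lemma sqrt2V : 2 * s^-1 = s /\ 0 < s^-1.
Proof.
have [s1 s2 ss] := sqrt2_facts R; have s0 : 0 < s by lra.
by rewrite invr_gt0 -{1}ss -mulrA divff ?gt_eqF // mulr1.
Qed.

(** Up to scaling, y is the difference of (x + y) / sqrt 2 and
(x - y) / sqrt 2, and the first of these is smooth. *)
Lemma smooth_quarter_turn x y : quarter_turn N x y -> smooth N x -> smooth N y.
Proof.
have [sV sV0] := sqrt2V; have [s1 s2 ss] := sqrt2_facts R.
move=> q sx; have sxy := smooth_sum q sx.
have q' := quarter_turnN hN (quarter_turn_rot hN q).
have su : smooth N (s^-1 *: (x + y)) by apply: (proj2 (smoothZ hN _ sV0)).
have := smooth_sum q' su.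
have -> : s^-1 *: (x + y) - s^-1 *: (x - y) = (2 * s^-1) *: y.
  by apply/rowP => i; rewrite !mxE; ring.
by rewrite sV; apply: (proj1 (smoothZ hN _ _)); lra.
Qed.

(** (p + q) / sqrt 2 supports N at x + y and (p - q) / sqrt 2 at x - y: taking
the differential of N commutes with the eighth turn.  The first-order condition
only gives f + g = a p and f - g = b q.  The same condition for the pair
(x + y) / sqrt 2, (x - y) / sqrt 2 makes p + q a multiple of f, hence a = b, and
evaluating at x and y gives a + b = 2 sqrt 2. *)
Lemma support_rot x y p q : quarter_turn N x y -> smooth N x ->
  supports N p x -> supports N q y ->
  [/\ p y + q x = 0, forall z, p z + q z <= s * N z &
      forall z, p z - q z <= s * N z].
Proof.
have [sV sV0] := sqrt2V; have [s1 s2 ss] := sqrt2_facts R.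
move=> t sx sp sq; have sy := smooth_quarter_turn t sx.
have [f sf] := exists_support hN (x + y); have [g sg] := exists_support hN (x - y).
have [x1 y1 h1 h2] := t.
have t' := quarter_turn_rot hN t.
have su : smooth N (s^-1 *: (x + y)).
  by apply: (proj2 (smoothZ hN _ sV0)); exact: smooth_sum.
have sf' : supports N f (s^-1 *: (x + y)) by apply: (proj2 (supportsZ hN _ _ sV0)).
have spu : supports N p (s^-1 *: (x + y) + s^-1 *: (x - y)).
  have -> : s^-1 *: (x + y) + s^-1 *: (x - y) = (2 * s^-1) *: x.
    by apply/rowP => i; rewrite !mxE; ring.
  by rewrite sV; apply: (proj2 (supportsZ hN _ _ _)) => //; lra.
have squ : supports N q (s^-1 *: (x + y) - s^-1 *: (x - y)).
  have -> : s^-1 *: (x + y) - s^-1 *: (x - y) = (2 * s^-1) *: y.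
    by apply/rowP => i; rewrite !mxE; ring.
  by rewrite sV; apply: (proj2 (supportsZ hN _ _ _)) => //; lra.
have e1 := support_sum_smooth t sx sf sg sp.
have sg' : supports N (fun v => - g v) (y - x).
  by rewrite -opprB; exact: supportsN.
have sf2 : supports N f (y + x) by rewrite addrC.
have e2 := support_sum_smooth (quarter_turn_sym hN t) sy sf2 sg' sq.
have e3 := support_sum_smooth t' su spu squ sf'.
have [pyl pyr] := quarter_turn_support_gt t sp.
have [qxl qxr] := quarter_turn_support_gt (quarter_turn_sym hN t) sq.
have [hp px pN] := sp; have [hq qy qN] := sq.
have [hf fN _] := sf; have [hg gN _] := sg.
move: e1 e2 e3 => /=.
set a := f x + g x; set b := f y - g y; set m := p _ + q _ => e1 e2 e3.
have pq z : (2 - m * a) * p z = (m * b - 2) * q z.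
  by have := e1 z; have := e2 z; have := e3 z; nra.
have ma : m * a = 2.
  have h := pq x; have h' := pq y; rewrite px x1 in h; rewrite qy y1 in h'.
  have : (2 - m * a) * (1 - p y * q x) = 0.
    by rewrite mulrBr h mulrA h'; ring.
  by move/eqP; rewrite mulf_eq0 => /orP[/eqP|/eqP] h''; [lra | nra].
have mb : m * b = 2 by have := pq y; rewrite ma qy y1; lra.
have m0 : m != 0 by apply/eqP => m0; move: ma; rewrite m0 mul0r; lra.
have ab : a = b by apply: (mulfI m0); rewrite ma mb.
have absum : a + b = 2 * s.
  by move: fN gN; rewrite !(lfE hf) !(lfE hg) h1 h2 /a /b; lra.
have as_ : a = s by lra.
have bs : b = s by lra.
have ms : m = s.
  have s0 : s != 0 by rewrite gt_eqF //; lra.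
  by apply: (mulIf s0); rewrite ss -as_.
split.
- have := e3 (x + y); rewrite fN h1 ms ss !(lfE hp) !(lfE hq) px qy x1 y1; lra.
- move=> z; rewrite e3 ms ler_wpM2l //; by case: sf.
move=> z; have -> : p z - q z = s * g z.
  apply: (mulfI (_ : s != 0)); first by rewrite gt_eqF //; lra.
  have := e1 z; have := e2 z; rewrite as_ bs mulrA ss mulrBr; lra.
by rewrite ler_wpM2l //; case: sg.
Qed.
End Smooth.

(** * Orthogonality is linear *)

Section Planar.
Variable R : realType.
Notation V := 'rV[R]_3.
Variables (N : V -> R) (hN : vector_norm N).
Hypothesis hJ : forall x y, N x = 1 -> N y = 1 -> N (x + y) * N (x - y) <= 2.
Notation s := (Num.sqrt 2 : R).

(** Split z into its component along e, measured by a functional supporting N at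
e, and a rest z - k e; N bounds both coordinates of a point of the line. *)
Lemma segment_norm_lower_bound e z : e != 0 -> (forall a, z != a *: e) ->
  exists r, 0 < r /\ forall t, r <= N ((1 - t) *: e + t *: z).
Proof.
move=> e0 ze; have [p [hp pe pN]] := exists_support hN e.
have ne := norm_gt0 hN e0.
pose k := p z / N e.
have z0 : z - k *: e != 0 by rewrite subr_eq0.
have nz := norm_gt0 hN z0.
pose K := (N e)^-1 + 2 * `|1 - k| / N (z - k *: e).
have K0 : 0 < K.
  by rewrite /K ltr_pwDl ?invr_gt0 // divr_ge0 ?(ltW nz) // mulr_ge0.
exists K^-1; split; first by rewrite invr_gt0.
move=> t; set D := (1 - t) *: e + t *: z.
pose a := 1 - t + t * k.
have DE : D = a *: e + t *: (z - k *: e).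
  by apply/rowP => i; rewrite !mxE /a; ring.
have pD : p D = a * N e.
  by rewrite /D !(lfE hp) pe /a /k; field; rewrite gt_eqF.
have h1 : `|a| * N e <= N D.
  rewrite -[N e]gtr0_norm // -normrM -pD.
  by apply: (supports_abs hN D (x := e)).
have h2 : `|t| * N (z - k *: e) <= 2 * N D.
  have := norm_triangle hN D (- (a *: e)).
  rewrite {1}DE addrAC subrr add0r (norm_opp hN) !(norm_scale hN); lra.
rewrite -[leLHS]mul1r ler_pdivrMr //.
have h3 : 1 <= `|a| + `|t| * `|1 - k|.
  rewrite -normrM; apply: le_trans (ler_normD _ _).
  by rewrite (_ : a + _ = 1) ?normr1 // /a; ring.
apply: (le_trans h3); rewrite /K mulrDr; apply: lerD.
  by rewrite ler_pdivlMr.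
have -> : N D * (2 * `|1 - k| / N (z - k *: e)) = 2 * N D / N (z - k *: e) * `|1 - k|.
  by ring.
by rewrite ler_wpM2r // ler_pdivlMr.
Qed.

(** For each t choose a quarter turn y t = l t (D t) + k t x over the point D t of
the segment from e to z, so that k t = p (y t).  Comparing y u with the
functionals supporting N at x + y t and x - y t gives
|k u - k t| <= 1 - Q t (y u), where Q t supports N at y t.  With g t = 1 / l t
this becomes a bound by a multiple of g u - g t - (u - t) b t.  So g is convex
with subgradient b, and adding the bound with t and u exchanged gives
increments of k of the kind that force k to be constant. *)
Lemma quarter_turn_height_const x p e z l0 k0 l1 k1 :
  smooth N x -> supports N p x -> p e = 0 -> p z = 0 ->
  e != 0 -> (forall a, z != a *: e) -> 0 < l0 -> 0 < l1 ->
  quarter_turn N x (l0 *: e + k0 *: x) -> quarter_turn N x (l1 *: z + k1 *: x) ->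
  k1 = k0.
Proof.
move=> sx sp pe pz e0 ze l00 l10 q0 q1; have [s1 s2 ss] := sqrt2_facts R.
have [r [r0 hr]] := segment_norm_lower_bound e0 ze.
have [hp px pN] := sp; have [x1 _ _ _] := q0.
pose D t := (1 - t) *: e + t *: z.
have pD t : p (D t) = 0 by rewrite !(lfE hp) pe pz !mulr0 addr0.
have DB t u : D u = D t + (u - t) *: (z - e).
  by apply/rowP => i; rewrite !mxE; ring.
have D0 : D 0 = e by rewrite /D subr0 scale1r scale0r addr0.
have D1 : D 1 = z by rewrite /D subrr scale1r scale0r add0r.
have {}hr t : r <= N (D t) := hr t.
clearbody D.
pose good t (lk : R * R) := 0 < lk.1 /\ quarter_turn N x (lk.1 *: D t + lk.2 *: x).
(* The quarter turns over the two ends of the segment are the given ones. *)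
have ex t : exists lk, good t lk /\ (t = 0 -> lk = (l0, k0)) /\ (t = 1 -> lk = (l1, k1)).
  have [->|t0] := eqVneq t 0.
    exists (l0, k0); split; first by rewrite /good /= D0.
    by split=> // /eqP; rewrite eq_sym oner_eq0.
  have [->|t1] := eqVneq t 1.
    exists (l1, k1); split; first by rewrite /good /= D1.
    by split=> // /eqP; rewrite oner_eq0.
  have Dx a : D t != a *: x.
    apply/eqP => h; have := hr t; rewrite h.
    have a0 : a = 0 by have := pD t; rewrite h (lfE hp) px x1 mulr1.
    by rewrite a0 scale0r (norm_0 hN); lra.
  have [l [k /= [l_gt0 y1 yiso]]] := isosceles_in_half_plane hN x1 Dx.
  exists (l, k); split; first by split => //; exact: isosceles_quarter_turn.
  by split=> h; [move: t0 | move: t1]; rewrite h eqxx.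
have [F hF] := choice ex.
pose l t := (F t).1; pose k t := (F t).2.
pose y t := l t *: D t + k t *: x.
have l_gt0 t : 0 < l t by case: (hF t) => -[].
have qy t : quarter_turn N x (y t) by case: (hF t) => -[].
have kE0 : k 0 = k0 by rewrite /k; case: (hF 0) => _ [-> //].
have kE1 : k 1 = k1 by rewrite /k; case: (hF 1) => _ [_ ->].
have [Q hQ] := choice (fun t => exists_support hN (y t)).
have py t : p (y t) = k t by rewrite /y !(lfE hp) pD px x1 mulr0 add0r mulr1.
have k_small t : - 1 / 2 < k t < 1 / 2.
  by rewrite -py; apply/andP; exact: (quarter_turn_support_gt (qy t) sp).
have Qx t : Q t x = - k t.
  by have [h _ _] := support_rot hN hJ (qy t) sx sp (hQ t); rewrite py in h; lra.
pose b t := Q t (z - e) / (1 + k t * k t).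
pose g t := (l t)^-1.
have w0 t : 0 < 1 + k t * k t by rewrite ltr_pwDl // -expr2 sqr_ge0.
have QD t u : Q t (D u) = (1 + k t * k t) * (g t + (u - t) * b t).
  have [hq qyt _] := hQ t; have [_ yt1 _ _] := qy t.
  have e1 : l t * Q t (D t) = 1 + k t * k t.
    by move: qyt; rewrite yt1 /y (lfE hq) !(lfE hq) Qx; lra.
  have lt0 : l t != 0 by rewrite gt_eqF.
  have e2 : Q t (D t) = (1 + k t * k t) * g t.
    by rewrite -e1 /g; field.
  rewrite (DB t u) (lfE hq) (lfE hq) e2 /b; field.
  by rewrite gt_eqF //; exact: w0.
have key t u : `|k u - k t| <= 8 / r * (g u - g t - (u - t) * b t).
  have [_ hs hd] := support_rot hN hJ (qy t) sx sp (hQ t).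
  have [hq qyt _] := hQ t; have [_ yt1 _ _] := qy t.
  have [_ yu1 p1 p2] := qy u.
  have qyu : Q t (y u) = l u * Q t (D u) - k u * k t.
    by rewrite /y (lfE hq) !(lfE hq) Qx; ring.
  have A : `|k u - k t| <= 1 - Q t (y u).
    have lin (f : V -> R) : linear_form f -> f (x + y u) = f x + f (y u) /\
        f (x - y u) = f x - f (y u).
      by move=> hf; rewrite (lfE hf).1.1 (lfE hf).1.1 (lfE hf).2.
    have [pa pb] := lin p hp; have [qa qb] := lin (Q t) hq.
    have := hs (x + y u); have := hd (x - y u).
    rewrite p1 p2 ss pa pb qa qb px x1 py Qx => h1 h2.
    by rewrite ler_norml; apply/andP; split; lra.
  pose X := g u - g t - (u - t) * b t.
  have lg : l u * g u = 1 by rewrite /g divff ?gt_eqF.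
  have B : 1 - Q t (y u) = (1 + k t * k t) * (l u * X) + k t * (k u - k t).
    rewrite qyu QD /X.
    have -> : l u * (g u - g t - (u - t) * b t) =
      1 - l u * (g t + (u - t) * b t) by rewrite -lg; ring.
    ring.
  have l_le : l u * r <= 2.
    have h : l u * N (D u) <= 2.
      rewrite -(norm_scale_ge0 hN) ?(ltW (l_gt0 u)) //.
      have := norm_triangle hN (y u) (- (k u *: x)).
      have -> : y u - k u *: x = l u *: D u by rewrite /y addrK.
      rewrite (norm_opp hN) (norm_scale hN (k u)) x1 yu1 mulr1.
      have /andP[ku1 ku2] := k_small u.
      have : `|k u| <= 1 by rewrite ler_norml; apply/andP; split; lra.
      lra.
    apply: le_trans h; rewrite ler_pM2l //; exact: hr.
  have /andP[kt1 kt2] := k_small t.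
  have C : k t * (k u - k t) <= `|k u - k t| / 2.
    apply: (le_trans (ler_norm _)); rewrite normrM mulrC ler_wpM2l //.
    by rewrite ler_norml; apply/andP; split; lra.
  have E : `|k u - k t| <= 2 * ((1 + k t * k t) * (l u * X)) by lra.
  have X0 : 0 <= X.
    have : 0 <= 2 * ((1 + k t * k t) * (l u * X)) by apply: le_trans E.
    by rewrite pmulr_rge0 // pmulr_rge0 // pmulr_rge0.
  apply: (le_trans E); rewrite -/X.
  have w2 : 1 + k t * k t <= 2 by nra.
  have lr : l u <= 2 / r by rewrite ler_pdivlMr.
  have -> : 8 / r * X = 2 * (2 * (2 / r * X)) by ring.
  rewrite ler_pM2l // ler_pM ?(ltW (w0 t)) //.
    by rewrite mulr_ge0 // ltW.
  by rewrite ler_wpM2r.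
rewrite -kE0 -kE1.
apply: (@constant_of_monotone_increments _ _ (fun t => 8 / r * b t)) => t u _ tu _.
have h1 := key t u; have h2 := key u t.
rewrite distrC in h2.
have : 0 <= `|k u - k t| by [].
move: h1 h2; move: `|k u - k t| (8 / r) => A B h1 h2 A0.
have -> : (B * b u - B * b t) * (u - t) =
  B * (g u - g t - (u - t) * b t) + B * (g t - g u - (t - u) * b u) by ring.
lra.
Qed.

(** Choose a third direction z, in the kernel of p.  The height p is the same at
y and over z, and the same at - y and over z. *)
Lemma quarter_turn_orthogonal x y p : smooth N x -> quarter_turn N x y ->
  supports N p x -> p y = 0.
Proof.
move=> sx q sp; have [x1 y1 h1 h2] := q; have [hp px pN] := sp.
pose e := y - p y *: x.
have pe : p e = 0 by rewrite /e !(lfE hp) px x1; ring.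
have yE : y = 1 *: e + p y *: x by rewrite scale1r subrK.
have e0 : e != 0.
  apply/eqP => e0; move: yE h1; rewrite e0 scaler0 add0r => yE.
  have [h h'] := quarter_turn_support_gt q sp.
  have : `|p y| = 1 by have := y1; rewrite yE (norm_scale hN) x1 mulr1 (lfE hp) px x1 mulr1.
  have : `|p y| < 1 by rewrite ltr_norml; apply/andP; split; lra.
  by move=> + a; rewrite a ltxx.
have [r sr] := exists_support hN e; have [hr re _] := sr.
have [z [z0 pz rz]] := common_kernel hp hr.
have ne : 0 < N e := norm_gt0 hN e0.
have ze a : z != a *: e.
  apply: contra_neq z0 => h; move: rz; rewrite h (lfE hr) re => /eqP.
  by rewrite mulf_eq0 (gt_eqF ne) orbF => /eqP ->; rewrite scale0r.
have zx a : z != a *: x.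
  apply: contra_neq z0 => h; move: pz; rewrite h (lfE hp) px x1 mulr1 => ->.
  by rewrite scale0r.
have [l [k /= [l0 w1 wiso]]] := isosceles_in_half_plane hN x1 zx.
have qw := isosceles_quarter_turn hN hJ x1 w1 wiso.
have k1 : k = p y.
  by apply: (quarter_turn_height_const sx sp pe pz e0 ze ltr01 l0 _ qw); rewrite -yE.
have k2 : k = - p y.
  have pe' : p (- e) = 0 by rewrite (lfE hp) pe oppr0.
  have e0' : - e != 0 by rewrite oppr_eq0.
  have ze' a : z != a *: - e by rewrite scalerN -scaleNr.
  apply: (quarter_turn_height_const sx sp pe' pz e0' ze' ltr01 l0 _ qw).
  by rewrite scalerN scaleNr -opprD -yE; exact: quarter_turnN.
lra.
Qed.

(** The quarter turn found in the half-plane of y has height 0, so it is y. *)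
Lemma orthogonal_quarter_turn x y p : smooth N x -> supports N p x ->
  N x = 1 -> N y = 1 -> p y = 0 -> quarter_turn N x y.
Proof.
move=> sx sp x1 y1 py; have [hp px _] := sp.
have y0 := norm1_neq0 hN y1.
have yx a : y != a *: x.
  apply: contra_neq y0 => h; move: py; rewrite h (lfE hp) px x1 mulr1 => ->.
  by rewrite scale0r.
have [l [k /= [l0 w1 wiso]]] := isosceles_in_half_plane hN x1 yx.
have qw := isosceles_quarter_turn hN hJ x1 w1 wiso.
have := quarter_turn_orthogonal sx qw sp.
rewrite !(lfE hp) py px x1 mulr0 mulr1 add0r => k0.
move: w1 qw; rewrite k0 scale0r addr0 (norm_scale_ge0 hN) ?(ltW l0) // y1 mulr1 => ->.
by rewrite scale1r.
Qed.

(** Let a be smooth and w = h + c a with h orthogonal to a.  Some unit z is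
orthogonal to a and to h.  It is smooth, and by symmetry of quarter turns its
supporting functional vanishes at a and h, hence at w; so w forms a quarter
turn with z. *)
Lemma smooth_everywhere x : x != 0 -> smooth N x.
Proof.
move=> x0; suff unit_case w : N w = 1 -> smooth N w.
  have i0 : 0 < (N x)^-1 by rewrite invr_gt0 norm_gt0.
  by apply: (proj1 (smoothZ hN x i0)); apply: unit_case; exact: norm_normalize.
move=> w1; have [a [a1 sa]] := exists_smooth_unit hN.
have [p sp] := exists_support hN a; have [hp pa _] := sp.
pose h := w - p w *: a.
have ph : p h = 0 by rewrite /h !(lfE hp) pa a1; ring.
have wE : w = h + p w *: a by rewrite subrK.
clearbody h.
have [h0|h0] := eqVneq h 0.
  move: wE; rewrite h0 add0r; move: (p w) => c wE.
  have : `|c| = 1 by have := w1; rewrite wE (norm_scale hN) a1 mulr1.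
  rewrite wE; case: (leP 0 c) => hs.
    by rewrite ger0_norm // => ->; rewrite scale1r.
  rewrite ltr0_norm // => /eqP; rewrite eqr_oppLR => /eqP ->.
  by rewrite scaleN1r; exact: smoothN.
have nh := norm_gt0 hN h0.
have i0 : 0 < (N h)^-1 by rewrite invr_gt0.
pose k := (N h)^-1 *: h.
have k1 : N k = 1 by exact: norm_normalize.
have pk : p k = 0 by rewrite /k (lfE hp) ph mulr0.
have sk : smooth N k.
  by apply: smooth_quarter_turn hN hJ _ _ (orthogonal_quarter_turn sa sp a1 k1 pk) sa.
have [q sq] := exists_support hN k; have [hq _ _] := sq.
have [z' [z0 pz' qz']] := common_kernel hp hq.
pose z := (N z')^-1 *: z'.
have z1 : N z = 1 by exact: norm_normalize.
have pz : p z = 0 by rewrite /z (lfE hp) pz' mulr0.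
have qz : q z = 0 by rewrite /z (lfE hq) qz' mulr0.
have taz := orthogonal_quarter_turn sa sp a1 z1 pz.
have tkz := orthogonal_quarter_turn sk sq k1 z1 qz.
have sz : smooth N z := smooth_quarter_turn hN hJ taz sa.
have [r sr] := exists_support hN z; have [hr _ _] := sr.
have ra := quarter_turn_orthogonal sz (quarter_turn_sym hN taz) sr.
have rk := quarter_turn_orthogonal sz (quarter_turn_sym hN tkz) sr.
have rw : r w = 0.
  rewrite wE (lfE hr) (lfE hr) ra mulr0 addr0.
  by move: rk; rewrite /k (lfE hr) => /eqP; rewrite mulf_eq0 (gt_eqF i0) /= => /eqP.
exact: smooth_quarter_turn hN hJ _ _ (orthogonal_quarter_turn sz sr z1 w1 rw) sz.
Qed.
End Planar.

(** * Change of orthonormal frame in a plane *)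

(** A 2 x 2 matrix with rows (a, b) and (c, d) is orthogonal up to the defect
(1 - a) + (1 - d) plus the square of an off-diagonal entry, provided b + c is
bounded by that defect. *)
Lemma rotation_defect (R : realType) (a b c d F G n h : R) :
  0 <= a <= 1 -> 0 <= d <= 1 -> `|c| <= 1 -> `|b| <= 1 ->
  `|F| <= n -> `|G| <= n ->
  `|b + c| <= 2 - a - d -> c ^+ 2 <= h ->
  `|(a * F + b * G) ^+ 2 + (c * F + d * G) ^+ 2 - (F ^+ 2 + G ^+ 2)|
    <= n ^+ 2 * (12 * (2 - a - d) + 3 * h).
Proof.
move=> /andP[a0 a1] /andP[d0 d1] c1 b1 Fn Gn bc ch.
have n0 : 0 <= n by apply: le_trans Fn.
pose e := 2 - a - d.
have F2 : F ^+ 2 <= n ^+ 2 by rewrite -[F ^+ 2]real_normK ?num_real // ler_pXn2r ?nnegrE.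
have G2 : G ^+ 2 <= n ^+ 2 by rewrite -[G ^+ 2]real_normK ?num_real // ler_pXn2r ?nnegrE.
have FG : `|F * G| <= n ^+ 2 by rewrite normrM expr2 ler_pM.
have e0 : 0 <= e by rewrite /e; lra.
have -> : (a * F + b * G) ^+ 2 + (c * F + d * G) ^+ 2 - (F ^+ 2 + G ^+ 2) =
  (a ^+ 2 + c ^+ 2 - 1) * F ^+ 2 + (b ^+ 2 + d ^+ 2 - 1) * G ^+ 2 +
  2 * (a * b + c * d) * (F * G) by ring.
have B1 : `|a ^+ 2 + c ^+ 2 - 1| <= 2 * e + h.
  rewrite ler_norml; apply/andP; split; rewrite /e; first by have := sqr_ge0 c; nra.
  nra.
have bc1 : (b + c) ^+ 2 <= 2 * e.
  rewrite -[(b + c) ^+ 2]real_normK ?num_real // expr2.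
  apply: ler_pM => //.
  by apply: (le_trans (ler_normD _ _)); lra.
have b2 : b ^+ 2 <= 4 * e + 2 * h.
  have : b ^+ 2 <= 2 * (b + c) ^+ 2 + 2 * c ^+ 2.
    have -> : 2 * (b + c) ^+ 2 + 2 * c ^+ 2 = b ^+ 2 + (b + 2 * c) ^+ 2 by ring.
    by rewrite lerDl sqr_ge0.
  lra.
have B2 : `|b ^+ 2 + d ^+ 2 - 1| <= 6 * e + 2 * h.
  have h0 : 0 <= h by apply: le_trans ch; exact: sqr_ge0.
  rewrite ler_norml; apply/andP; split; rewrite /e in b2 *.
    by have := sqr_ge0 b; nra.
  nra.
have B3 : `|2 * (a * b + c * d)| <= 4 * e.
  have -> : 2 * (a * b + c * d) = 2 * (b + c) - 2 * ((1 - a) * b) - 2 * ((1 - d) * c) by ring.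
  have k1 : `|(1 - a) * b| <= 1 - a.
    by rewrite normrM ger0_norm ?subr_ge0 // ler_piMr ?subr_ge0.
  have k2 : `|(1 - d) * c| <= 1 - d.
    by rewrite normrM ger0_norm ?subr_ge0 // ler_piMr ?subr_ge0.
  move: k1 k2 bc; rewrite !ler_norml => /andP[? ?] /andP[? ?] /andP[? ?].
  by rewrite /e; apply/andP; split; lra.
apply: (le_trans (ler_normD _ _)).
have := ler_normD ((a ^+ 2 + c ^+ 2 - 1) * F ^+ 2) ((b ^+ 2 + d ^+ 2 - 1) * G ^+ 2).
have T1 : `|(a ^+ 2 + c ^+ 2 - 1) * F ^+ 2| <= (2 * e + h) * n ^+ 2.
  by rewrite normrM ler_pM // ger0_norm // sqr_ge0.
have T2 : `|(b ^+ 2 + d ^+ 2 - 1) * G ^+ 2| <= (6 * e + 2 * h) * n ^+ 2.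
  by rewrite normrM ler_pM // ger0_norm // sqr_ge0.
have T3 : `|2 * (a * b + c * d) * (F * G)| <= 4 * e * n ^+ 2.
  by rewrite normrM ler_pM.
rewrite -/e; lra.
Qed.

(** Here (a, b) and (c, d) are the rows of a change of frame, and a0, d0 the
diagonal entries of its inverse.  The four inequalities bound b + c by
(1 - a) + (1 - d), and d * d0 = a0 * a bounds 1 - d by (1 - a0) + (1 - a).
If d <= 0 the same holds after changing the sign of the second row. *)
Lemma frame_defect (R : realType) (a b c d a0 d0 X Y n h : R) :
  d * d0 = a0 * a -> `|a| <= 1 -> `|d| <= 1 -> `|c| <= 1 -> `|b| <= 1 ->
  `|a0| <= 1 -> `|d0| <= 1 ->
  a + b + (c + d) <= 2 -> a - b + (c - d) <= 2 ->
  a + b - (c + d) <= 2 -> a - b - (c - d) <= 2 ->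
  c ^+ 2 <= h -> `|X| <= n -> `|Y| <= n ->
  `|a * X + b * Y| <= n -> `|c * X + d * Y| <= n ->
  `|(a * X + b * Y) ^+ 2 + (c * X + d * Y) ^+ 2 - (X ^+ 2 + Y ^+ 2)| <=
    24 * n ^+ 2 * (1 - a0 + (1 - a) + h).
Proof.
move=> dd a1 d1 c1 b1 a01 d01 j1 j2 j3 j4 ch Xn Yn Xn' Yn'.
have n0 : 0 <= n by apply: le_trans Xn.
have h0 : 0 <= h by apply: le_trans ch; exact: sqr_ge0.
have n2 : 0 <= n ^+ 2 by exact: sqr_ge0.
move: (a1) (d1) (a01) (d01); rewrite !(ler_norml _ 1).
move=> /andP[a2 a3] /andP[d2 d3] /andP[a4 a5] /andP[d4 d5].
have sq (x : R) : `|x| <= n -> 0 <= x ^+ 2 <= n ^+ 2.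
  move=> xn; rewrite sqr_ge0 -[x ^+ 2]real_normK ?num_real //=.
  by rewrite ler_pXn2r ?nnegrE.
have triv : 1 <= 1 - a0 + (1 - a) + h ->
    `|(a * X + b * Y) ^+ 2 + (c * X + d * Y) ^+ 2 - (X ^+ 2 + Y ^+ 2)| <=
    24 * n ^+ 2 * (1 - a0 + (1 - a) + h).
  move=> k1; apply: (@le_trans _ _ (24 * n ^+ 2 * 1)); last first.
    by apply: ler_wpM2l k1; rewrite mulr_ge0.
  move: (sq _ Xn) (sq _ Yn) (sq _ Xn') (sq _ Yn').
  move: (_ ^+ 2) (_ ^+ 2) (_ ^+ 2) (_ ^+ 2) (_ ^+ 2) => x1 x2 x3 x4 x5.
  clear; move=> /andP[? ?] /andP[? ?] /andP[? ?] /andP[? ?].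
  by rewrite ler_norml; apply/andP; split; lra.
(* When a or a0 is not positive the trivial bound 2 * n ^ 2 is enough. *)
have [ha|ha] := leP a 0; first by apply: triv; clear - ha a5 h0; lra.
have [ha0|ha0] := leP a0 0; first by apply: triv; clear - ha0 a3 h0; lra.
have aa : 0 < a0 * a by rewrite mulr_gt0.
have aa1 : 1 - a0 * a <= 1 - a0 + (1 - a).
  have : 0 <= (1 - a0) * (1 - a) by rewrite mulr_ge0 // subr_ge0.
  rewrite mulrBl mulrBr; clear; lra.
have fin (e : R) : e <= 2 * (1 - a) + (1 - a0) ->
    n ^+ 2 * (12 * e + 3 * h) <= 24 * n ^+ 2 * (1 - a0 + (1 - a) + h).
  move=> he; have -> : 24 * n ^+ 2 * (1 - a0 + (1 - a) + h) =
    n ^+ 2 * (24 * (1 - a0 + (1 - a) + h)) by ring.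
  apply: ler_wpM2l => //; clear - he h0 a3 a5; lra.
have a01' : 0 <= a <= 1 by rewrite a3 ltW.
have [hd|hd] := ltP 0 d.
  have hd' : a0 * a <= d by rewrite -dd ler_piMr // ltW.
  apply: le_trans (fin (2 - a - d) _); last by clear - hd' aa1; lra.
  apply: rotation_defect => //; first by rewrite d3 ltW.
  by rewrite ler_norml; clear - j1 j4; apply/andP; split; lra.
have hd' : a0 * a <= - d by rewrite -dd -mulrNN ler_piMr ?oppr_ge0 // lerNl.
have -> : (c * X + d * Y) ^+ 2 = (- c * X + - d * Y) ^+ 2 by ring.
apply: le_trans (fin (2 - a - - d) _); last by clear - hd' aa1; lra.
apply: rotation_defect => //; rewrite ?normrN ?sqrrN //.
  by rewrite oppr_ge0 hd lerNl.
by rewrite ler_norml; clear - j2 j3; apply/andP; split; lra.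
Qed.

Section Plane.
Variable R : realType.
Notation V := 'rV[R]_3.
Variables (N : V -> R) (hN : vector_norm N).
Hypothesis hJ : forall x y, N x = 1 -> N y = 1 -> N (x + y) * N (x - y) <= 2.
Notation s := (Num.sqrt 2 : R).

Definition in_plane (a b u : V) := exists k l, u = k *: a + l *: b.

Lemma in_plane_comb a b u v k l :
  in_plane a b u -> in_plane a b v -> in_plane a b (k *: u + l *: v).
Proof.
move=> [k1 [l1 ->]] [k2 [l2 ->]]; exists (k * k1 + l * k2), (k * l1 + l * l2).
by apply/rowP => i; rewrite !mxE; ring.
Qed.

(** For 2 x 2 matrices a one-sided inverse is two-sided. *)
Lemma dual_basis_plane a b p q (f g : V -> R) u :
  linear_form f -> linear_form g ->
  f p = 1 -> f q = 0 -> g p = 0 -> g q = 1 ->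
  in_plane a b p -> in_plane a b q -> in_plane a b u -> u = f u *: p + g u *: q.
Proof.
move=> hf hg fp fq gp gq [k1 [l1 pE]] [k2 [l2 qE]] [k [l ->]].
move: fp fq gp gq; rewrite pE qE !(lfE hf) !(lfE hg).
move: (f a) (f b) (g a) (g b) => fa fb ga gb e1 e2 e3 e4.
pose D := k1 * l2 - k2 * l1.
have Dfa : D * fa = l2.
  have -> : D * fa = l2 * (k1 * fa + l1 * fb) - l1 * (k2 * fa + l2 * fb) by rewrite /D; ring.
  by rewrite e1 e2; ring.
have Dfb : D * fb = - k2.
  have -> : D * fb = k1 * (k2 * fa + l2 * fb) - k2 * (k1 * fa + l1 * fb) by rewrite /D; ring.
  by rewrite e1 e2; ring.
have Dga : D * ga = - l1.
  have -> : D * ga = l2 * (k1 * ga + l1 * gb) - l1 * (k2 * ga + l2 * gb) by rewrite /D; ring.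
  by rewrite e3 e4; ring.
have Dgb : D * gb = k1.
  have -> : D * gb = k1 * (k2 * ga + l2 * gb) - k2 * (k1 * ga + l1 * gb) by rewrite /D; ring.
  by rewrite e3 e4; ring.
have D0 : D != 0.
  apply/eqP => D0; move: Dfa Dfb; rewrite D0 !mul0r => h1 h2.
  have k20 : k2 = 0 by lra.
  by move: e4; rewrite -h1 k20; lra.
have E1 : (k * fa + l * fb) * k1 + (k * ga + l * gb) * k2 = k.
  apply: (mulfI D0).
  have -> : D * ((k * fa + l * fb) * k1 + (k * ga + l * gb) * k2) =
    k * (D * fa * k1 + D * ga * k2) + l * (D * fb * k1 + D * gb * k2) by ring.
  by rewrite Dfa Dfb Dga Dgb /D; ring.
have E2 : (k * fa + l * fb) * l1 + (k * ga + l * gb) * l2 = l.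
  apply: (mulfI D0).
  have -> : D * ((k * fa + l * fb) * l1 + (k * ga + l * gb) * l2) =
    k * (D * fa * l1 + D * ga * l2) + l * (D * fb * l1 + D * gb * l2) by ring.
  by rewrite Dfa Dfb Dga Dgb /D; ring.
apply/rowP => i; rewrite !mxE.
transitivity (((k * fa + l * fb) * k1 + (k * ga + l * gb) * k2) * a 0 i +
  ((k * fa + l * fb) * l1 + (k * ga + l * gb) * l2) * b 0 i).
  by rewrite E1 E2.
by ring.
Qed.

(** An orthonormal pair p, q together with functionals supporting N at p and
q. *)
Definition frame p q f g :=
  [/\ N p = 1, N q = 1, supports N f p, supports N g q & f q = 0].

Lemma frame_facts p q f g : frame p q f g ->
  [/\ g p = 0, quarter_turn N p q, forall z, f z + g z <= s * N z &
      forall z, f z - g z <= s * N z].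
Proof.
case=> p1 q1 sf sg fq.
have sp := smooth_everywhere hN hJ (norm1_neq0 hN p1).
have t := orthogonal_quarter_turn hN hJ sp sf p1 q1 fq.
have [h1 h2 h3] := support_rot hN hJ t sp sf sg.
by split=> //; lra.
Qed.

(** The two frames are inverse bases of the plane, whence
(g' q) (g q') = (f p') (f' p); the inequalities between the entries are those of
support_rot for f' + g' and f' - g' at p + q and p - q. *)
Lemma frame_change a b p q f g p' q' f' g' v :
  frame p q f g -> frame p' q' f' g' ->
  in_plane a b p -> in_plane a b q -> in_plane a b p' -> in_plane a b q' ->
  in_plane a b v ->
  `|f' v ^+ 2 + g' v ^+ 2 - (f v ^+ 2 + g v ^+ 2)| <=
    24 * N v ^+ 2 * ((1 - f p') + (1 - f' p) + N (p - p') ^+ 2).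
Proof.
move=> F F' Pp Pq Pp' Pq' Pv.
have [gp t _ _] := frame_facts F; have [gp' t' i1 i2] := frame_facts F'.
have [p1 q1 sf sg fq] := F; have [p1' q1' sf' sg' fq'] := F'.
have [hf fp fN] := sf; have [hg gq gN] := sg.
have [hf' fp' fN'] := sf'; have [hg' gq' gN'] := sg'.
rewrite p1 in fp; rewrite q1 in gq; rewrite p1' in fp'; rewrite q1' in gq'.
have p'E := dual_basis_plane hf hg fp fq gp gq Pp Pq Pp'.
have vE := dual_basis_plane hf hg fp fq gp gq Pp Pq Pv.
have qE := dual_basis_plane hf' hg' fp' fq' gp' gq' Pp' Pq' Pq.
have abs1 (k : V -> R) w z : supports N k w -> N z = 1 -> `|k z| <= 1.
  by move=> sk <-; exact: (supports_abs hN z sk).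
have c1 := abs1 _ _ _ sg' p1; have b1 := abs1 _ _ _ sf' q1.
have a1 := abs1 _ _ _ sf' p1; have d1 := abs1 _ _ _ sg' q1.
have fp'1 := abs1 _ _ _ sf p1'; have gq'1 := abs1 _ _ _ sg q1'.
have Fn := supports_abs hN v sf; have Gn := supports_abs hN v sg.
have Fn' := supports_abs hN v sf'; have Gn' := supports_abs hN v sg'.
have [_ _ pq1 pq2] := t.
have [s1 s2 ss] := sqrt2_facts R.
have ab1 : f p' * f' p + g p' * f' q = 1.
  by move: fp'; rewrite {1}p'E !(lfE hf').
have ab2 : f' q * g p' + g' q * g q' = 1.
  by move: gq; rewrite {1}qE !(lfE hg).
have dd : g' q * g q' = f p' * f' p by lra.
have v1 : f' v = f' p * f v + f' q * g v by rewrite {1}vE !(lfE hf'); ring.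
have v2 : g' v = g' p * f v + g' q * g v by rewrite {1}vE !(lfE hg'); ring.
have c2 : g' p ^+ 2 <= N (p - p') ^+ 2.
  have -> : g' p = g' (p - p') by rewrite !(lfE hg') gp' subr0.
  rewrite -[g' _ ^+ 2]real_normK ?num_real // ler_pXn2r ?nnegrE ?(norm_ge0 hN) //.
  exact: (supports_abs hN _ sg').
have j1 := i1 (p + q); have j2 := i1 (p - q).
have j3 := i2 (p + q); have j4 := i2 (p - q).
rewrite pq1 ss !(lfE hf') !(lfE hg') in j1.
rewrite pq2 ss !(lfE hf') !(lfE hg') in j2.
rewrite pq1 ss !(lfE hf') !(lfE hg') in j3.
rewrite pq2 ss !(lfE hf') !(lfE hg') in j4.
rewrite v1 in Fn' *; rewrite v2 in Gn' *.
exact: frame_defect dd a1 d1 c1 b1 fp'1 gq'1 j1 j2 j3 j4 c2 Fn Gn Fn' Gn'.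
Qed.
End Plane.

(** * Planes are Euclidean *)

Section Euclid.
Variable R : realType.
Notation V := 'rV[R]_3.
Variables (N : V -> R) (hN : vector_norm N).
Hypothesis hJ : forall x y, N x = 1 -> N y = 1 -> N (x + y) * N (x - y) <= 2.

Lemma exists_frame a b p : a != 0 -> (forall k, b != k *: a) ->
  in_plane a b p -> N p = 1 ->
  exists q f g, in_plane a b q /\ frame N p q f g.
Proof.
move=> a0 ba Pp p1; have [f sf] := exists_support hN p; have [hf fp fN] := sf.
have Pa : in_plane a b a by exists 1, 0; rewrite scale1r scale0r addr0.
have Pb : in_plane a b b by exists 0, 1; rewrite scale1r scale0r add0r.
have [e [Pe e0]] : exists e, in_plane a b e /\ e - f e *: p != 0.
  have [ha|ha] := eqVneq (a - f a *: p) 0; last by exists a.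
  exists b; split=> //; rewrite subr_eq0; apply: contra_neq (ba (f b / f a)) => hb.
  move/eqP: ha; rewrite subr_eq0 => /eqP ha.
  have fa : f a != 0 by apply: contra_neq a0 => h; rewrite ha h scale0r.
  by rewrite [LHS]hb [X in _ = _ *: X]ha scalerA divfK.
pose d := e - f e *: p; pose q := (N d)^-1 *: d.
have Pd : in_plane a b d.
  have -> : d = 1 *: e + (- f e) *: p by rewrite scale1r scaleNr.
  exact: in_plane_comb.
have fd : f d = 0 by rewrite /d !(lfE hf) fp p1; ring.
have [g sg] := exists_support hN q.
exists q, f, g; split.
  have -> : q = (N d)^-1 *: d + 0 *: d by rewrite scale0r addr0.
  exact: in_plane_comb.
split=> //; first exact: norm_normalize.
by rewrite /q (lfE hf) fd mulr0.
Qed.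

(** Move the first vector of the frame along the segment from p0 to h, normalised.
The defects 1 - F t (p u) and 1 - F u (p t) are controlled by the subgradient c
of the convex function t |-> N (D t), so f^2 + g^2 keeps its value at h.  At the
end of the path h is a multiple of the first vector, and the value is
N h ^+ 2. *)
Lemma plane_euclidean a b : a != 0 -> (forall k, b != k *: a) ->
  exists f g, [/\ linear_form f, linear_form g &
    forall u, in_plane a b u -> N u ^+ 2 = f u ^+ 2 + g u ^+ 2].
Proof.
move=> a0 ba.
have na : 0 < N a := norm_gt0 hN a0.
pose p0 := (N a)^-1 *: a.
have p01 : N p0 = 1 by exact: norm_normalize.
have Pp0 : in_plane a b p0 by exists (N a)^-1, 0; rewrite scale0r addr0.
(* The frame is a function of its first vector, so that the frame at p0 is the
   same for all h. *)
have ex p : exists T : V * (V -> R) * (V -> R),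
    in_plane a b p -> N p = 1 -> in_plane a b T.1.1 /\ frame N p T.1.1 T.1.2 T.2.
  have [hp|hp] := pselect (in_plane a b p /\ N p = 1).
    have [q [f [g h]]] := exists_frame a0 ba hp.1 hp.2.
    by exists (q, f, g).
  by exists (0, N, N) => h1 h2; case: hp.
have [T hT] := choice ex.
pose q p := (T p).1.1; pose f p := (T p).1.2; pose g p := (T p).2.
have {}hT p : in_plane a b p -> N p = 1 -> in_plane a b (q p) /\ frame N p (q p) (f p) (g p).
  exact: hT.
have [_ F0] := hT _ Pp0 p01.
have [gp0 _ _ _] := frame_facts hN hJ F0.
have [_ _ [hf0 fp0 _] [hg0 _ _] _] := F0.
clearbody q f g; clear ex T.
exists (f p0), (g p0); split=> // h Ph.
have [[k hk]|hk] := pselect (exists k, h = k *: p0).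
  by rewrite hk (norm_scale hN) (lfE hf0) (lfE hg0) fp0 p01 gp0 !mulr1 mulr0
    expr0n addr0 real_normK ?num_real.
have p00 := norm1_neq0 hN p01.
have hp0 k : h != k *: p0 by apply/eqP => e; apply: hk; exists k.
have [r [r0 hr]] := segment_norm_lower_bound hN p00 hp0.
pose D t := (1 - t) *: p0 + t *: h.
have DB t u : D u = D t + (u - t) *: (h - p0).
  by apply/rowP => i; rewrite !mxE; ring.
have D0 : D 0 = p0 by rewrite /D subr0 scale1r scale0r addr0.
have D1 : D 1 = h by rewrite /D subrr scale1r scale0r add0r.
have PD t : in_plane a b (D t) by exact: in_plane_comb.
have {}hr t : r <= N (D t) := hr t.
clearbody D.
pose n t := N (D t); have n0 t : 0 < n t by exact: lt_le_trans (hr t).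
pose p t := (n t)^-1 *: D t.
have Dt0 t : D t != 0.
  by apply/eqP => e; have := n0 t; rewrite /n e (norm_0 hN) ltxx.
have p1 t : N (p t) = 1 by exact: norm_normalize.
have Pp t : in_plane a b (p t).
  have -> : p t = (n t)^-1 *: D t + 0 *: D t by rewrite scale0r addr0.
  exact: in_plane_comb.
have pE0 : p 0 = p0 by rewrite /p /n D0 p01 invr1 scale1r.
have Dn t : D t = n t *: p t.
  by rewrite /p scalerA divff ?scale1r // gt_eqF.
clearbody p.
pose F t := f (p t); pose G t := g (p t).
have fr t : in_plane a b (q (p t)) /\ frame N (p t) (q (p t)) (F t) (G t).
  exact: hT.
have L0 : 0 <= N (h - p0) := norm_ge0 hN _.
set L := N (h - p0) in L0.
pose c t := F t (h - p0).
have gap t u : 1 - F t (p u) <= r^-1 * (n u - n t - (u - t) * c t).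
  have [_ [_ _ [hF Fp FN] _ _]] := fr t.
  have e : n u * F t (p u) = n t + (u - t) * c t.
    rewrite -(lfE hF) -Dn (DB t) (lfE hF) (lfE hF) Dn (lfE hF) Fp p1 mulr1.
    by rewrite -/(c t).
  have X0 : 0 <= n u - n t - (u - t) * c t.
    by have := FN (D u); rewrite {1}Dn (lfE hF) e -/(n u); lra.
  have -> : 1 - F t (p u) = (n u)^-1 * (n u - n t - (u - t) * c t).
    have -> : n u - n t - (u - t) * c t = n u * (1 - F t (p u)) by rewrite mulrBr e; ring.
    by rewrite mulrA mulVf ?gt_eqF // mul1r.
  by rewrite ler_wpM2r // lef_pV2 ?posrE //; exact: hr.
have dist t u : N (p t - p u) <= 2 / r * L * `|u - t|.
  (* Both the points D t and their norms are Lipschitz in t. *)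
  have e : n t *: (p t - p u) = (t - u) *: (h - p0) + (n u - n t) *: p u.
    have -> : n t *: (p t - p u) = D t - D u + (n u - n t) *: p u.
      by rewrite [D t]Dn [D u]Dn; apply/rowP => i; rewrite !mxE; ring.
    by rewrite (DB u t); congr (_ + _); rewrite addrAC subrr add0r.
  have h1 : `|n u - n t| <= `|u - t| * L.
    apply: (le_trans (norm_distance hN _ _)).
    by rewrite (DB t u) addrAC subrr add0r (norm_scale hN).
  have h2 : n t * N (p t - p u) <= 2 * L * `|u - t|.
    rewrite -(norm_scale_ge0 hN) ?(ltW (n0 t)) // e.
    apply: (le_trans (norm_triangle hN _ _)).
    rewrite !(norm_scale hN) p1 mulr1 distrC -/L; lra.
  have h3 : r * N (p t - p u) <= 2 * L * `|u - t|.
    by apply: le_trans h2; rewrite ler_wpM2r ?(norm_ge0 hN) //; exact: hr.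
  have -> : 2 / r * L * `|u - t| = (2 * L * `|u - t|) / r by ring.
  by rewrite ler_pdivlMr // mulrC.
pose K := (2 / r * L) ^+ 2.
pose m t := 24 * N h ^+ 2 * (r^-1 * c t + K * t).
have := @constant_of_monotone_increments _ (fun t => F t h ^+ 2 + G t h ^+ 2) m.
have -> : F 0 h ^+ 2 + G 0 h ^+ 2 = f p0 h ^+ 2 + g p0 h ^+ 2 by rewrite /F /G pE0.
have -> : F 1 h ^+ 2 + G 1 h ^+ 2 = N h ^+ 2.
  have [_ fr1] := fr 1; have [gp _ _ _] := frame_facts hN hJ fr1.
  have [_ _ [hF Fp _] [hG _ _] _] := fr1.
  have hE : h = n 1 *: p 1 by rewrite -Dn D1.
  rewrite {1 2}hE (lfE hF) (lfE hG) Fp gp p1 mulr1 mulr0 expr0n addr0.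
  by rewrite /n D1.
apply=> t u _ tu _.
have [Pq frt] := fr t; have [Pq' fru] := fr u.
apply: (le_trans (frame_change hN hJ frt fru (Pp t) Pq (Pp u) Pq' Ph)).
have -> : (m u - m t) * (u - t) = 24 * N h ^+ 2 *
    (r^-1 * (n u - n t - (u - t) * c t) + r^-1 * (n t - n u - (t - u) * c u)
     + K * (u - t) ^+ 2) by rewrite /m; ring.
apply: ler_wpM2l; first by rewrite mulr_ge0 // sqr_ge0.
apply: lerD; first exact: lerD.
have -> : K * (u - t) ^+ 2 = (2 / r * L * `|u - t|) ^+ 2.
  by rewrite exprMn real_normK ?num_real.
rewrite ler_pXn2r ?nnegrE ?(norm_ge0 hN) //.
exact: le_trans (norm_ge0 hN _) (dist t u).
Qed.
End Euclid.

(** * From planes to an inner product *)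

Section Transfer.
Variables (R : realType) (X : normedModType R).
Hypothesis hJ : forall x y : X, `|x| = 1 -> `|y| = 1 -> `|x + y| * `|x - y| <= 2.

(** The coordinates given by v pull the norm of X back to row vectors. *)
Lemma plane_quadratic (v : 'I_3 -> X) : lin_indep v ->
  exists A B C : R, forall k l : R,
    `|k *: v 0 + l *: v 1| ^+ 2 = k ^+ 2 * A + k * l * B + l ^+ 2 * C.
Proof.
move=> hv.
pose L (w : 'rV[R]_3) : X := \sum_i w 0 i *: v i.
have LZD (c : R) w1 w2 : L (c *: w1 + w2) = c *: L w1 + L w2.
  rewrite /L scaler_sumr -big_split; apply: eq_bigr => i _.
  by rewrite !mxE scalerDl scalerA.
have L0 : L 0 = 0 by apply: big1 => i _; rewrite mxE scale0r.
have LD w1 w2 : L (w1 + w2) = L w1 + L w2.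
  by have := LZD 1 w1 w2; rewrite !scale1r.
have LZ c w : L (c *: w) = c *: L w.
  by have := LZD c w 0; rewrite L0 !addr0.
have LB w1 w2 : L (w1 - w2) = L w1 - L w2.
  by rewrite -scaleN1r LD LZ scaleN1r.
have Ld i : L (delta_mx 0 i) = v i.
  rewrite /L (bigD1 i) //= big1 => [|j ji]; first by rewrite mxE !eqxx scale1r addr0.
  by rewrite mxE (negPf ji) andbF scale0r.
pose N w := `|L w|.
have hN : vector_norm N.
  split=> [w /eqP|c w|w1 w2]; rewrite /N.
  - rewrite normr_eq0 => /eqP Lw; apply/rowP => i; rewrite mxE.
    exact: (hv (fun i => w 0 i)).
  - by rewrite LZ normrZ.
  - by rewrite LD ler_normD.
have hNJ x y : N x = 1 -> N y = 1 -> N (x + y) * N (x - y) <= 2.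
  by rewrite /N LD LB; exact: hJ.
pose a : 'rV[R]_3 := delta_mx 0 0; pose b : 'rV[R]_3 := delta_mx 0 1.
have a0 : a != 0.
  by apply/eqP => /rowP/(_ 0); rewrite !mxE /= => /eqP; rewrite oner_eq0.
have ba k : b != k *: a.
  by apply/eqP => /rowP/(_ 1); rewrite !mxE /= mulr0 => /eqP; rewrite oner_eq0.
have [f [g [hf hg fg]]] := plane_euclidean hN hNJ a0 ba.
exists (f a ^+ 2 + g a ^+ 2), (2 * (f a * f b + g a * g b)), (f b ^+ 2 + g b ^+ 2).
move=> k l.
have -> : `|k *: v 0 + l *: v 1| = N (k *: a + l *: b).
  by rewrite /N LD !LZ !Ld.
rewrite fg; last by exists k, l.
by rewrite !(lfE hf) !(lfE hg); ring.
Qed.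
End Transfer.

Section JordanVonNeumann.
Variables (R : realType) (X : normedModType R).
Hypothesis plane : forall x y : X, exists A B C : R, forall k l : R,
    `|k *: x + l *: y| ^+ 2 = k ^+ 2 * A + k * l * B + l ^+ 2 * C.

Let sq (x : X) := `|x| ^+ 2.

Definition polar_form (x y : X) : R := (`|x + y| ^+ 2 - `|x| ^+ 2 - `|y| ^+ 2) / 2.

Lemma parallelogram x y : sq (x + y) + sq (x - y) = 2 * sq x + 2 * sq y.
Proof.
have [A [B [C h]]] := plane x y; rewrite /sq.
have := h 1 1; have := h 1 (-1); have := h 1 0; have := h 0 1.
rewrite !scale1r !scale0r scaleN1r addr0 add0r => -> -> -> ->; ring.
Qed.

Lemma polar_formZ k x y : polar_form (k *: x) y = k * polar_form x y.
Proof.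
have [A [B [C h]]] := plane x y; rewrite /polar_form.
have := h k 1; have := h 1 1; have := h k 0; have := h 1 0; have := h 0 1.
rewrite !scale1r !scale0r !addr0 add0r => -> -> -> -> ->; lra.
Qed.

Lemma polar_formC x y : polar_form x y = polar_form y x.
Proof. by rewrite /polar_form [x + y]addrC; ring. Qed.

(** The squared norm of x + y + z is computed from the parallelogram law for the
pairs (x + y, z), (x - z, y), (x, y + z) and (x, z). *)
Lemma polar_formD x y z : polar_form (x + y) z = polar_form x z + polar_form y z.
Proof.
rewrite /polar_form -!/(sq _).
have h1 := parallelogram (x + y) z.
have h2 := parallelogram (x - z) y.
have h3 := parallelogram x (y + z).
have h4 := parallelogram x z.
have e1 : x - z + y = x + y - z by rewrite addrAC.
have e2 : x - (y + z) = x - z - y by rewrite opprD addrCA addrC addrAC.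
rewrite e1 in h2; rewrite addrA e2 in h3.
lra.
Qed.

Lemma polar_form_diag x : polar_form x x = `|x| ^+ 2.
Proof.
rewrite /polar_form -mulr2n -scaler_nat normrZ ger0_norm //; lra.
Qed.

Lemma polar_formB x y z : polar_form (x - y) z = polar_form x z - polar_form y z.
Proof. by rewrite polar_formD -scaleN1r polar_formZ mulN1r. Qed.

Lemma polar_form_bilinear :
  [/\ forall z, zmod_morphism (polar_form ^~ z), forall z, zmod_morphism (polar_form z),
     forall z, scalable_for *%R (polar_form ^~ z) &
     forall z, scalable_for (idfun \; *%R) (polar_form z)].
Proof.
split=> z => [x y|x y|k x|k x] /=.
- exact: polar_formB.
- by rewrite ![polar_form z _]polar_formC polar_formB.
- exact: polar_formZ.
- by rewrite ![polar_form z _]polar_formC polar_formZ.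
Qed.

HB.instance Definition _ := sesquilinear.isBilinear.Build R X X R *%R
  (idfun \; *%R) polar_form
  (let: And4 h _ _ _ := polar_form_bilinear in h)
  (let: And4 _ h _ _ := polar_form_bilinear in h)
  (let: And4 _ _ h _ := polar_form_bilinear in h)
  (let: And4 _ _ _ h := polar_form_bilinear in h).

Lemma polar_form_hermitian x y :
  polar_form x y = (-1) ^+ false * idfun (polar_form y x).
Proof. by rewrite expr0 mul1r polar_formC. Qed.

HB.instance Definition _ := sesquilinear.isHermitianSesquilinear.Build R X
  false idfun polar_form polar_form_hermitian.

Lemma polar_form_gt0 x : x != 0 -> 0 < polar_form x x.
Proof. by move=> x0; rewrite polar_form_diag exprn_gt0 // normr_gt0. Qed.

HB.instance Definition _ := sesquilinear.isDotProduct.Build R X polar_form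
  polar_form_gt0.

Lemma norm_from_polar_form : norm_from_inner_product X.
Proof.
exists (polar_form : @sesquilinear.Dot.type R X idfun) => x.
by rewrite /= polar_form_diag sqrtr_sqr normr_id.
Qed.
End JordanVonNeumann.

(** The supremum defining T2 is over a set bounded by 2. *)
Lemma T2_bound (R : realType) (X : normedModType R) : T2 1 1 X = Num.sqrt 2 ->
  forall x y : X, `|x| = 1 -> `|y| = 1 -> `|x + y| * `|x - y| <= 2.
Proof.
move=> hT x y x1 y1.
suff : Num.sqrt (`|x + y| * `|x - y|) <= Num.sqrt 2 by rewrite ler_sqrt.
rewrite -hT; apply: sup_upper_bound; last first.
  by exists x => //; exists y => //; rewrite !scale1r.
split; first by exists (Num.sqrt (`|x + y| * `|x - y|)), x => //; exists y => //; rewrite !scale1r.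
exists (Num.sqrt (2 * 2)) => _ [u u1 [v v1 <-]].
rewrite !scale1r ler_sqrt // ler_pM //.
  by apply: (le_trans (ler_normD _ _)); rewrite u1 v1.
by apply: (le_trans (ler_normB _ _)); rewrite u1 v1.
Qed.

(** If the three given independent vectors were combinations of x and y, a common
zero of the two coordinate forms would be a linear relation between them. *)
Lemma extend_to_triple (R : realType) (X : normedModType R) (x y : X) :
  dim_ge 3 X -> x != 0 -> (forall k, y != k *: x) ->
  exists v : 'I_3 -> X, [/\ lin_indep v, v 0 = x & v 1 = y].
Proof.
move=> [w hw] x0 yx.
have [z hz] : exists z, forall k l : R, z != k *: x + l *: y.
  apply: contrapT => hz.
  have hw2 i : exists kl : R * R, w i = kl.1 *: x + kl.2 *: y.
    apply: contrapT => hi; apply: hz; exists (w i) => k l; apply/eqP => e.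
    by apply: hi; exists (k, l).
  have [F hF] := choice hw2.
  have hlin (G : 'I_3 -> R) : linear_form (fun c : 'rV[R]_3 => \sum_i c 0 i * G i).
    move=> k u v; rewrite mulr_sumr -big_split /=; apply: eq_bigr => i _.
    by rewrite !mxE; ring.
  have [c [/eqP c0 h1 h2]] :=
    common_kernel (hlin (fun i => (F i).1)) (hlin (fun i => (F i).2)).
  apply: c0; apply/rowP => i; rewrite mxE.
  apply: (hw (fun i => c 0 i)).
  transitivity ((\sum_i c 0 i * (F i).1) *: x + (\sum_i c 0 i * (F i).2) *: y).
    rewrite !scaler_suml -big_split; apply: eq_bigr => j _.
    by rewrite {1}hF scalerDr !scalerA.
  by rewrite h1 h2 !scale0r addr0.
pose v (i : 'I_3) := if i == 0 then x else if i == 1 then y else z.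
exists v; split=> // c.
rewrite !big_ord_recl big_ord0 addr0 /v /=.
set c0 := c ord0; set c1 := c _; set c2 := c _ => e.
have c20 : c2 = 0.
  apply: contrapT => /eqP c20; have := hz (- c2^-1 * c0) (- c2^-1 * c1).
  move=> /eqP; apply; rewrite -!scalerA -scalerDr scaleNr.
  apply: (scalerI c20); rewrite scalerN scalerA divff // scale1r.
  by apply/eqP; rewrite -addr_eq0 addrC -addrA e.
have c10 : c1 = 0.
  apply: contrapT => /eqP c10; have := yx (- c1^-1 * c0).
  move=> /eqP; apply; rewrite -!scalerA scaleNr.
  apply: (scalerI c10); rewrite scalerN scalerA divff // scale1r.
  by apply/eqP; rewrite -addr_eq0 addrC; move: e; rewrite c20 scale0r addr0 => ->.
have c00 : c0 = 0.
  move: e; rewrite c20 c10 !scale0r !addr0 => /eqP.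
  by rewrite scaler_eq0 (negPf x0) orbF => /eqP.
move=> i; have [-> //|[->|->]] : i = ord0 \/ i = lift ord0 ord0 \/ i = lift ord0 (lift ord0 ord0).
- by case: i => [[|[|[|?]]] ?] //; [left | right; left | right; right]; apply: val_inj.
- exact: c10.
- exact: c20.
Qed.

Theorem mainTheorem6 (R : realType) (X : completeNormedModType R)
    (hdim : dim_ge 3 X) (hT : T2 1 1 X = Num.sqrt 2) :
  norm_from_inner_product X.
Proof.
apply: norm_from_polar_form => x y.
have [->|x0] := eqVneq x 0.
  by exists 0, 0, (`|y| ^+ 2) => k l; rewrite scaler0 add0r normrZ exprMn real_normK ?num_real //; ring.
have [[c ->]|yx] := pselect (exists c, y = c *: x).
  exists (`|x| ^+ 2), (2 * c * `|x| ^+ 2), (c ^+ 2 * `|x| ^+ 2) => k l.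
  by rewrite scalerA -scalerDl normrZ exprMn real_normK ?num_real //; ring.
have yx' c : y != c *: x by apply/eqP => e; apply: yx; exists c.
have [v [hv v0 v1]] := extend_to_triple hdim x0 yx'.
by have := plane_quadratic (T2_bound hT) hv; rewrite v0 v1.
Qed.
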